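(* Let $M=\{(\rho,\theta,\phi,\psi)\in\mathbb{R}^4:\ \rho>0,\ 0<\theta<\pi\}$ with the Euclidean Taub-NUT metric $$g_{TN}=\frac{\rho+1}{4\rho}\,d\rho^2+\rho(\rho+1)\left(\sigma_1^2+\sigma_2^2\right)+\frac{\rho}{\rho+1}\,\sigma_3^2 ,$$ where $\sigma_1=\tfrac12(\sin\psi\,d\theta-\sin\theta\cos\psi\,d\phi)$, $\sigma_2=\tfrac12(\cos\psi\,d\theta+\sin\theta\sin\psi\,d\phi)$, $\sigma_3=\tfrac12(d\psi+\cos\theta\,d\phi)$. Consider the one-forms $$e^1=\sqrt{\tfrac{\rho+1}{4\rho}}\left(\rho\cos\theta\cos\phi\,d\theta+\sin\theta(\cos\phi\,d\rho-\rho\sin\phi\,d\phi)\right),$$ $$e^2=\sqrt{\tfrac{\rho+1}{4\rho}}\left(\rho\cos\theta\sin\phi\,d\theta+\sin\theta(\sin\phi\,d\rho+\rho\cos\phi\,d\phi)\right),$$ $$e^3=\sqrt{\tfrac{\rho+1}{4\rho}}\left(-\rho\sin\theta\,d\theta+\cos\theta\,d\rho\right),\qquad e^4=\sqrt{\tfrac{\rho}{4(\rho+1)}}\left(\cos\theta\,d\phi+d\psi\right),$$ and let $(e_1,e_2,e_3,e_4)$ be the dual frame of vector fields. Define almost complex structures by $$J_1e_1=e_2,\quad J_1e_2=-e_1,\quad J_1e_3=e_4,\quad J_1e_4=-e_3,$$ $$J_2e_1=e_4,\quad J_2e_2=e_3,\quad J_2e_3=-e_2,\quad J_2e_4=-e_1,$$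 $$J_3e_1=e_3,\quad J_3e_2=-e_4,\quad J_3e_3=-e_1,\quad J_3e_4=e_2.$$ Then $(e^1,e^2,e^3,e^4)$ is an orthonormal coframe for $g_{TN}$, and $g_{TN}$ is hyper-Kähler with respect to $(J_1,J_2,J_3)$. Explicitly: (1) $g_{TN}(J_iX,J_iY)=g_{TN}(X,Y)$ for $i=1,2,3$ and all vector fields $X,Y$, and the associated 2-forms $\omega_i(X,Y)=g_{TN}(J_iX,Y)$ are $$\omega_1=e^1\wedge e^2+e^3\wedge e^4,\quad \omega_2=e^1\wedge e^4+e^2\wedge e^3,\quad \omega_3=e^1\wedge e^3+e^4\wedge e^2,$$ which are self-dual for the orientation $e^1\wedge e^2\wedge e^3\wedge e^4$; (2) $d\omega_1=d\omega_2=d\omega_3=0$; (3) $J_1^2=J_2^2=J_3^2=-\mathrm{Id}$ and $J_1J_2=-J_2J_1=J_3$, together with the cyclic permutations of this relation, where the product $J_iJ_j$ means that $J_i$ is applied first and then $J_j$; (4) each $J_i$ is integrable, i.e. its Nijenhuis tensor vanishes identically.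
   Context: The Nijenhuis tensor of an almost complex structure $J$ is $N(X,Y)=[X,Y]+J[JX,Y]+J[X,JY]-[JX,JY]$ for vector fields $X,Y$; $J$ is integrable if and only if $N\equiv0$. A Riemannian metric $g$ is Hermitian for $J$ if $g(JX,JY)=g(X,Y)$; its Kähler form is $\omega(X,Y)=g(JX,Y)$; it is Kähler if $J$ is integrable and $d\omega=0$. A $4k$-dimensional Riemannian manifold is hyper-Kähler if it is Kähler with respect to three complex structures satisfying the quaternionic relations. Products of the $J_i$ are taken in the convention in which $J$ is represented by the matrix $(J_\sigma{}^\alpha)$ with $J\partial_\sigma=J_\sigma{}^\alpha\partial_\alpha$ (row index $\sigma$), so that the matrix product $J_iJ_j$ corresponds to applying $J_i$ first and $J_j$ second; equivalently, as compositions of linear maps, $J_2\circ J_1=-J_1\circ J_2=J_3$. *)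

(* Defs.v *)
From HB Require Import structures.
From mathcomp Require Import all_boot all_order all_algebra.
From mathcomp Require Import all_classical all_reals all_analysis.
Import Order.TTheory GRing.Theory Num.Theory.
Import numFieldNormedType.Exports.

Set Implicit Arguments.
Unset Strict Implicit.
Unset Printing Implicit Defensive.

Local Open Scope classical_set_scope.
Local Open Scope ring_scope.

(* Tensor fields on an open subset of R^4, in the global coordinates of       *)
(* 'rV[R]_4. At a point:                                                      *)
(*  - a tangent vector v = v^i d_i is the row vector of its components;       *)
(*  - a covector a = a_i dx^i is a column vector, and a(v) = v *m a;          *)
(*  - a bilinear form b is the matrix b_ij = b(d_i, d_j);                     *)
(*  - an endomorphism J is the matrix with J d_i = \sum_j J_ij d_j, so that   *)
(*    J v = v *m J, and J *m K is J followed by K.                            *)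
(* Fields are total functions, constrained only on the set U of interest.     *)

Definition pairing (R : realType) (a : 'cV[R]_4) (v : 'rV[R]_4) : R :=
  (v *m a) 0 0.

Definition bil (R : realType) (b : 'M[R]_4) (u v : 'rV[R]_4) : R :=
  (u *m b *m v^T) 0 0.

Definition tensor (R : realType) (a b : 'cV[R]_4) : 'M[R]_4 := a *m b^T.

(* (a /\ b)(u, v) = a(u) b(v) - b(u) a(v), without a factor 1/2 *)
Definition wedge (R : realType) (a b : 'cV[R]_4) : 'M[R]_4 :=
  tensor a b - tensor b a.

Definition partial (R : realType) (V : normedModType R) (i : 'I_4)
    (f : 'rV[R]_4 -> V) (p : 'rV[R]_4) : V :=
  'D_(delta_mx 0 i) f p.

Fixpoint Ck_on (R : realType) (V : normedModType R) (k : nat)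
    (U : set 'rV[R]_4) (f : 'rV[R]_4 -> V) : Prop :=
  (forall p, U p -> {for p, continuous f}) /\
  match k with
  | 0%N => True
  | k'.+1 => forall i : 'I_4,
      (forall p, U p -> derivable f p (delta_mx 0 i)) /\
      Ck_on k' U (partial i f)
  end.

Definition smooth_on (R : realType) (V : normedModType R)
    (U : set 'rV[R]_4) (f : 'rV[R]_4 -> V) : Prop :=
  forall k, Ck_on k U f.

Definition lie_bracket (R : realType) (X Y : 'rV[R]_4 -> 'rV[R]_4)
    (p : 'rV[R]_4) : 'rV[R]_4 :=
  \sum_(i < 4) (X p 0 i *: partial i Y p - Y p 0 i *: partial i X p).

Definition apply_endo (R : realType) (J : 'rV[R]_4 -> 'M[R]_4)
    (X : 'rV[R]_4 -> 'rV[R]_4) (p : 'rV[R]_4) : 'rV[R]_4 := X p *m J p.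

Definition nijenhuis (R : realType) (J : 'rV[R]_4 -> 'M[R]_4)
    (X Y : 'rV[R]_4 -> 'rV[R]_4) (p : 'rV[R]_4) : 'rV[R]_4 :=
  lie_bracket X Y p
  + apply_endo J (lie_bracket (apply_endo J X) Y) p
  + apply_endo J (lie_bracket X (apply_endo J Y)) p
  - lie_bracket (apply_endo J X) (apply_endo J Y) p.

Definition integrable_on (R : realType) (U : set 'rV[R]_4)
    (J : 'rV[R]_4 -> 'M[R]_4) : Prop :=
  forall X Y : 'rV[R]_4 -> 'rV[R]_4, smooth_on U X -> smooth_on U Y ->
  forall p, U p -> nijenhuis J X Y p = 0.

(* the component (d w)_ijk of the exterior derivative of a 2-form w *)
Definition ext_deriv (R : realType) (w : 'rV[R]_4 -> 'M[R]_4)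
    (i j k : 'I_4) (p : 'rV[R]_4) : R :=
  partial i (fun q => w q j k) p + partial j (fun q => w q k i) p
  + partial k (fun q => w q i j) p.

Definition closed_on (R : realType) (U : set 'rV[R]_4)
    (w : 'rV[R]_4 -> 'M[R]_4) : Prop :=
  forall p, U p -> forall i j k, ext_deriv w i j k p = 0.

Definition riemannian_on (R : realType) (U : set 'rV[R]_4)
    (g : 'rV[R]_4 -> 'M[R]_4) : Prop :=
  smooth_on U g /\
  forall p, U p ->
    (forall u v, bil (g p) u v = bil (g p) v u) /\
    (forall v, v != 0 -> 0 < bil (g p) v v).

Definition almost_complex_on (R : realType) (U : set 'rV[R]_4)
    (J : 'rV[R]_4 -> 'M[R]_4) : Prop :=
  smooth_on U J /\ forall p, U p -> J p *m J p = - 1%:M.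

Definition hermitian_on (R : realType) (U : set 'rV[R]_4)
    (g J : 'rV[R]_4 -> 'M[R]_4) : Prop :=
  forall p, U p -> forall X Y,
    bil (g p) (X *m J p) (Y *m J p) = bil (g p) X Y.

(* the matrix of (X, Y) |-> g(J X, Y) = X *m J *m g *m Y^T *)
Definition kahler_form (R : realType) (g J : 'rV[R]_4 -> 'M[R]_4)
    (p : 'rV[R]_4) : 'M[R]_4 := J p *m g p.

Definition kahler_on (R : realType) (U : set 'rV[R]_4)
    (g J : 'rV[R]_4 -> 'M[R]_4) : Prop :=
  [/\ riemannian_on U g, almost_complex_on U J, hermitian_on U g J,
      integrable_on U J & closed_on U (kahler_form g J)].

Definition quaternionic_on (R : realType) (U : set 'rV[R]_4)
    (J1 J2 J3 : 'rV[R]_4 -> 'M[R]_4) : Prop :=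
  forall p, U p ->
  [/\ [/\ J1 p *m J1 p = - 1%:M, J2 p *m J2 p = - 1%:M
        & J3 p *m J3 p = - 1%:M],
      J1 p *m J2 p = J3 p /\ - (J2 p *m J1 p) = J3 p,
      J2 p *m J3 p = J1 p /\ - (J3 p *m J2 p) = J1 p
    & J3 p *m J1 p = J2 p /\ - (J1 p *m J3 p) = J2 p].

Definition hyperkahler_on (R : realType) (U : set 'rV[R]_4)
    (g J1 J2 J3 : 'rV[R]_4 -> 'M[R]_4) : Prop :=
  [/\ kahler_on U g J1, kahler_on U g J2, kahler_on U g J3
    & quaternionic_on U J1 J2 J3].

Definition levi_civita (R : realType) (a b c d : 'I_4) : R :=
  \det (\matrix_(r < 4) (delta_mx 0 (tnth [tuple a; b; c; d] r) : 'rV[R]_4)).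

(* The Hodge dual w' of a 2-form w: w'_ij = 1/2 vol_klij w^kl, with              *)
(* w^kl = g^ka g^lb w_ab, for the metric g and the orientation of the 4-form  *)
(* whose value on (d_0, d_1, d_2, d_3) is o.                                  *)
Definition hodge_star (R : realType) (g : 'M[R]_4) (o : R) (w : 'M[R]_4) :
    'M[R]_4 :=
  let vol := Num.sg o * Num.sqrt (\det g) in
  let w_up := invmx g *m w *m (invmx g)^T in
  \matrix_(i, j)
    (2^-1 * \sum_k \sum_l vol * levi_civita R k l i j * w_up k l).

Definition dual_frame_on (R : realType) (U : set 'rV[R]_4)
    (cofr : 'I_4 -> 'rV[R]_4 -> 'cV[R]_4)
    (fr : 'I_4 -> 'rV[R]_4 -> 'rV[R]_4) : Prop :=
  forall p, U p -> forall a b, pairing (cofr a p) (fr b p) = (a == b)%:R.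

(* g^-1(e^a, e^b) = delta_ab for the metric g^-1 induced on covectors *)
Definition orthonormal_coframe_on (R : realType) (U : set 'rV[R]_4)
    (g : 'rV[R]_4 -> 'M[R]_4) (cofr : 'I_4 -> 'rV[R]_4 -> 'cV[R]_4) : Prop :=
  forall p, U p -> forall a b,
    bil (invmx (g p)) (cofr a p)^T (cofr b p)^T = (a == b)%:R.

Definition rho (R : realType) (p : 'rV[R]_4) : R := p 0 0.
Definition theta (R : realType) (p : 'rV[R]_4) : R := p 0 1.
Definition phi (R : realType) (p : 'rV[R]_4) : R := p 0 2.
Definition psi (R : realType) (p : 'rV[R]_4) : R := p 0 3.

Definition drho (R : realType) : 'cV[R]_4 := delta_mx 0 0.
Definition dtheta (R : realType) : 'cV[R]_4 := delta_mx 1 0.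
Definition dphi (R : realType) : 'cV[R]_4 := delta_mx 2 0.
Definition dpsi (R : realType) : 'cV[R]_4 := delta_mx 3 0.

Definition TN_dom (R : realType) : set 'rV[R]_4 :=
  [set p | 0 < rho p /\ 0 < theta p < pi].

Definition sigma1 (R : realType) (p : 'rV[R]_4) : 'cV[R]_4 :=
  2^-1 *: (sin (psi p) *: dtheta R - (sin (theta p) * cos (psi p)) *: dphi R).
Definition sigma2 (R : realType) (p : 'rV[R]_4) : 'cV[R]_4 :=
  2^-1 *: (cos (psi p) *: dtheta R + (sin (theta p) * sin (psi p)) *: dphi R).
Definition sigma3 (R : realType) (p : 'rV[R]_4) : 'cV[R]_4 :=
  2^-1 *: (dpsi R + cos (theta p) *: dphi R).

Definition g_TN (R : realType) (p : 'rV[R]_4) : 'M[R]_4 :=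
  let r := rho p in
  ((r + 1) / (4 * r)) *: tensor (drho R) (drho R)
  + (r * (r + 1)) *: (tensor (sigma1 p) (sigma1 p)
                      + tensor (sigma2 p) (sigma2 p))
  + (r / (r + 1)) *: tensor (sigma3 p) (sigma3 p).

Definition TN_e1 (R : realType) (p : 'rV[R]_4) : 'cV[R]_4 :=
  let: (r, t, f) := (rho p, theta p, phi p) in
  Num.sqrt ((r + 1) / (4 * r)) *:
    ((r * cos t * cos f) *: dtheta R
     + sin t *: (cos f *: drho R - (r * sin f) *: dphi R)).
Definition TN_e2 (R : realType) (p : 'rV[R]_4) : 'cV[R]_4 :=
  let: (r, t, f) := (rho p, theta p, phi p) in
  Num.sqrt ((r + 1) / (4 * r)) *:
    ((r * cos t * sin f) *: dtheta R
     + sin t *: (sin f *: drho R + (r * cos f) *: dphi R)).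
Definition TN_e3 (R : realType) (p : 'rV[R]_4) : 'cV[R]_4 :=
  let: (r, t) := (rho p, theta p) in
  Num.sqrt ((r + 1) / (4 * r)) *:
    (- (r * sin t) *: dtheta R + cos t *: drho R).
Definition TN_e4 (R : realType) (p : 'rV[R]_4) : 'cV[R]_4 :=
  let: (r, t) := (rho p, theta p) in
  Num.sqrt (r / (4 * (r + 1))) *: (cos t *: dphi R + dpsi R).

Definition TN_coframe (R : realType) (a : 'I_4) (p : 'rV[R]_4) : 'cV[R]_4 :=
  tnth [tuple TN_e1 p; TN_e2 p; TN_e3 p; TN_e4 p] a.

(* Column a is the covector e^a, so v *m TN_coframe_mx p is the row of the    *)
(* e^a(v), and the rows of the inverse are the vectors of the dual frame.     *)
Definition TN_coframe_mx (R : realType) (p : 'rV[R]_4) : 'M[R]_4 :=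
  \matrix_(i, a) TN_coframe a p i 0.

Definition TN_frame (R : realType) (a : 'I_4) (p : 'rV[R]_4) : 'rV[R]_4 :=
  row a (invmx (TN_coframe_mx p)).

(* the endomorphism field sending the frame vector e_a to im a, extended      *)
(* linearly: J v = \sum_a e^a(v) J(e_a)                                       *)
Definition TN_endo (R : realType) (im : 'rV[R]_4 -> 4.-tuple 'rV[R]_4)
    (p : 'rV[R]_4) : 'M[R]_4 :=
  \sum_(a < 4) TN_coframe a p *m tnth (im p) a.

Definition TN_J1 (R : realType) : 'rV[R]_4 -> 'M[R]_4 :=
  TN_endo (fun p => let e a := TN_frame a p in
    [tuple e 1; - e 0; e 3; - e 2]).
Definition TN_J2 (R : realType) : 'rV[R]_4 -> 'M[R]_4 :=
  TN_endo (fun p => let e a := TN_frame a p in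
    [tuple e 3; e 2; - e 1; - e 0]).
Definition TN_J3 (R : realType) : 'rV[R]_4 -> 'M[R]_4 :=
  TN_endo (fun p => let e a := TN_frame a p in
    [tuple e 2; - e 3; - e 0; e 1]).

(* orientation e^1 /\ e^2 /\ e^3 /\ e^4: its value on (d_0, d_1, d_2, d_3) *)
Definition TN_orientation (R : realType) (p : 'rV[R]_4) : R :=
  \det (TN_coframe_mx p).

(* Main.v *)
(* The metric is g = E E^T for the coframe matrix E, and J_i = E C_i E^-1 for
   constant skew matrices C_i satisfying the quaternion relations, so that
   omega_i = J_i g = E C_i E^T; everything except smoothness, closedness and
   integrability is then matrix algebra. The products of the square roots in
   omega_i are rational, and in terms of the Cartesian coordinates
   x = rho sin(theta) cos(phi), etc., one has the Gibbons-Hawking form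
     omega_1 = V dx /\ dy + dz /\ (dpsi + cos(theta) dphi) / 4,
   V = (rho + 1) / (4 rho), and similarly for omega_2 and omega_3; closedness is
   a computation with their entries. Integrability is not computed but follows
   from closedness (Hitchin): J_1 omega_2 = omega_3, and if w and J w are
   closed 2-forms with w nondegenerate, then w(N(X, Y), Z) is a combination of
   components of dw and d(J w), so N = 0. *)
Require Import Defs.
From HB Require Import structures.
From mathcomp Require Import all_boot all_order all_algebra.
From mathcomp Require Import all_classical all_reals all_analysis.
From mathcomp Require Import ring lra.
Import Order.TTheory GRing.Theory Num.Theory.
Import numFieldNormedType.Exports.

Set Implicit Arguments.
Unset Strict Implicit.
Unset Printing Implicit Defensive.

Local Open Scope classical_set_scope.
Local Open Scope ring_scope.

(** * Smooth elementary functions *)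

Section SmoothMatrixFunctions.
Context {R : realType}.
Implicit Types (U : set 'rV[R]_4) (p : 'rV[R]_4).

(** Fields are constrained on [U] only. As [U] is open, agreement on [U] is agreement near each of
    its points, and this is all that limits and derivatives see. *)
Lemma Ck_on_ext (V : normedModType R) k U (f h : 'rV[R]_4 -> V) :
  open U -> (forall p, U p -> f p = h p) -> Ck_on k U f -> Ck_on k U h.
Proof.
move=> Uo.
have nearW (u v : 'rV[R]_4 -> V) p :
    (forall q, U q -> u q = v q) -> U p -> {near p, u =1 v}.
  by move=> uv Up; apply: filterS uv _; exact: open_nbhs_nbhs.
have contW (u v : 'rV[R]_4 -> V) p : (forall q, U q -> u q = v q) -> U p ->
    {for p, continuous u} -> {for p, continuous v}.
  move=> uv Up; rewrite /prop_for /continuous_at -uv//.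
  exact: cvg_trans (near_eq_cvg (nearW _ _ _ uv Up)).
elim: k f h => [|k IHk] f h fh [fc fd].
  by split=> // p Up; apply: contW (fc p Up).
split=> [p Up|i]; first exact: contW (fc p Up).
have [fdi fk] := fd i; split.
  by move=> p Up; apply: near_eq_derivable (fdi p Up); exact: nearW.
by apply: IHk fk => p Up; apply: near_eq_derive; exact: nearW.
Qed.

Lemma continuous_mx (T : topologicalType) m n (f : T -> 'M[R]_(m, n)) (t : T) :
  (forall i j, {for t, continuous (fun x => f x i j)}) -> {for t, continuous f}.
Proof.
move=> fc; apply/cvgrPdist_le => e e0; near=> x.
rewrite /Num.Def.normr/= mx_normrE (bigmax_le _ (ltW e0))//= => i _.
rewrite !mxE/=; move: i; near: x; apply: filter_forall => /= i.
exact: ((cvgrPdist_le _ _).1 (fc i.1 i.2)).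
Unshelve. all: by end_near. Qed.

(** Derivatives of matrices are taken entrywise where the map is derivable, hence on [U];
    [Ck_on_ext] makes that enough for the induction. *)
Lemma Ck_on_mx k U m n (f : 'rV[R]_4 -> 'M[R]_(m, n)) : open U ->
  (forall i j, Ck_on k U (fun p => f p i j)) -> Ck_on k U f.
Proof.
move=> Uo; elim: k f => [|k IHk] f fij.
  by split=> // p Up; apply: continuous_mx => i j; exact: (fij i j).1.
have fd l p : U p -> derivable f p (delta_mx 0 l).
  by move=> Up; apply/derivable_mxP => i j; exact: ((fij i j).2 l).1.
split=> [p Up|l]; first by apply: continuous_mx => i j; exact: (fij i j).1.
split=> [|]; first exact: fd.
apply: IHk => i j; apply: Ck_on_ext ((fij i j).2 l).2 => // p Up.
by rewrite /partial [in RHS]derive_mx ?mxE//; exact: fd.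
Qed.

End SmoothMatrixFunctions.

(** * Symbolic differentiation of elementary functions *)

Section ElementaryExpressions.
Context {R : realType}.

(* Symbolic derivatives give smoothness, by induction on the order of
   differentiation, and also compute the exterior derivatives. *)
Inductive elem_fun := Inv | Sin | Cos | Sqrt.

Inductive expr :=
| Cst of R
| Var of 'I_4
| Add of expr & expr
| Mul of expr & expr
| App of elem_fun & expr.

Definition fun_eval (h : elem_fun) : R -> R :=
  match h with
  | Inv => fun x => x^-1 | Sin => sin | Cos => cos | Sqrt => Num.sqrt
  end.

(** [Sqrt] demands a strictly positive argument because the root is not differentiable at 0;
    positivity also makes the inverse in its derivative defined. *)
Definition fun_dom (h : elem_fun) (x : R) : Prop :=
  match h with Inv => x != 0 | Sqrt => 0 < x | _ => True end.

Fixpoint eval (e : expr) (p : 'rV[R]_4) : R :=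
  match e with
  | Cst c => c
  | Var i => p 0 i
  | Add a b => eval a p + eval b p
  | Mul a b => eval a p * eval b p
  | App h a => fun_eval h (eval a p)
  end.

Fixpoint defined (e : expr) (p : 'rV[R]_4) : Prop :=
  match e with
  | Cst _ | Var _ => True
  | Add a b | Mul a b => defined a p /\ defined b p
  | App h a => defined a p /\ fun_dom h (eval a p)
  end.

Definition fun_diff (h : elem_fun) (a : expr) : expr :=
  match h with
  | Inv => Mul (Cst (-1)) (Mul (App Inv a) (App Inv a))
  | Sin => App Cos a
  | Cos => Mul (Cst (-1)) (App Sin a)
  | Sqrt => App Inv (Mul (Cst 2) (App Sqrt a))
  end.

Fixpoint diff_expr (i : 'I_4) (e : expr) : expr :=
  match e with
  | Cst _ => Cst 0
  | Var j => Cst (j == i)%:R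
  | Add a b => Add (diff_expr i a) (diff_expr i b)
  | Mul a b => Add (Mul (diff_expr i a) b) (Mul a (diff_expr i b))
  | App h a => Mul (diff_expr i a) (fun_diff h a)
  end.

Lemma defined_fun_diff h a p : defined (App h a) p -> defined (fun_diff h a) p.
Proof.
case: h => /= -[da ha]//; do ?split=> //.
by rewrite mulf_neq0// gt_eqF// sqrtr_gt0.
Qed.

(** Differentiation never shrinks the domain, which lets the induction in [smooth_eval] reach every
    order. *)
Lemma defined_diff i e p : defined e p -> defined (diff_expr i e) p.
Proof.
elim: e => //= [a IHa b IHb|a IHa b IHb|h a IHa].
- by case=> /IHa + /IHb.
- by case=> da db; split; split; auto.
- by case=> da ha; split; [exact: IHa|exact: defined_fun_diff].
Qed.

Lemma is_derive_fun h a p : defined (App h a) p ->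
  is_derive (eval a p) 1 (fun_eval h) (eval (fun_diff h a) p).
Proof.
case: h => /= -[da ha].
- apply: is_derive_eq; first exact: is_deriveV.
  by rewrite /= scaler1 mulN1r -expr2 exprVn.
- exact: is_derive_sin.
- by rewrite mulN1r; exact: is_derive_cos.
- exact: is_derive1_sqrt.
Qed.

Lemma derive_comp (V : normedModType R) (f : V -> R) (h : R -> R) (x v : V) b :
  differentiable f x -> is_derive (f x) 1 h b ->
  differentiable (h \o f) x /\ 'D_v (h \o f) x = 'D_v f x * b.
Proof.
move=> df [/derivable1_diffP dh <-].
split; first exact: differentiable_comp.
rewrite deriveE; last exact: differentiable_comp.
by rewrite diff_comp//= diff1E// -deriveE// derive1E.
Qed.

Lemma differentiable_eval e p : defined e p -> differentiable (eval e) p.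
Proof.
elim: e => /= [c _|i _|a IHa b IHb [/IHa ? /IHb ?]|
               a IHa b IHb [/IHa ? /IHb ?]|].
- exact: differentiable_cst.
- exact: differentiable_coord.
- exact: differentiableD.
- exact: differentiableM.
- move=> h a IHa dha.
  by have [] := derive_comp 0 (IHa dha.1) (is_derive_fun dha).
Qed.

Lemma partial_eval i e p : defined e p ->
  partial i (eval e) p = eval (diff_expr i e) p.
Proof.
rewrite /partial.
elim: e => [c _|j _|a IHa b IHb /= [da db]|a IHa b IHb /= [da db]|h a IHa dha].
- exact: derive_cst.
- rewrite /= deriveE; last exact: differentiable_coord.
  (* The coordinate function is packaged as a linear map, so that it is its own differential. *)
  have @f : {linear 'rV[R]_4 -> R}.
    by exists (fun N : 'rV[R]_4 => N 0 j); do 2![eexists]; do ?[constructor];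
       rewrite ?mxE// => ? *; rewrite ?mxE//; move=> ?; rewrite !mxE.
  transitivity ('d f p (delta_mx 0 i)) => //.
  by rewrite diff_lin /= ?mxE ?eqxx//; exact: coord_continuous.
- rewrite -IHa// -IHb// -deriveD//; apply: diff_derivable;
  exact: differentiable_eval.
- rewrite -IHa// -IHb// addrC [_ * eval b p]mulrC.
  by apply: deriveM => //; apply: diff_derivable; exact: differentiable_eval.
- rewrite /= -IHa; last exact: dha.1.
  have da := differentiable_eval dha.1.
  by have [_] := derive_comp (delta_mx 0 i) da (is_derive_fun dha).
Qed.

Lemma smooth_eval U e : open U -> (forall p, U p -> defined e p) ->
  smooth_on U (eval e).
Proof.
move=> Uo + k; elim: k e => [|k IHk] e de.
  by split=> // p /de/differentiable_eval/differentiable_continuous.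
split=> [p /de/differentiable_eval/differentiable_continuous//|i]; split.
  by move=> p /de/differentiable_eval de_p; exact: diff_derivable.
have Dk : Ck_on k U (eval (diff_expr i e)).
  by apply: IHk => p /de; exact: defined_diff.
by apply: Ck_on_ext Dk => // p /de de_p; rewrite partial_eval.
Qed.

Definition elementary_on (U : set 'rV[R]_4) (f : 'rV[R]_4 -> R) :=
  exists e, forall p, U p -> defined e p /\ f p = eval e p.

Definition elementary_mx_on (U : set 'rV[R]_4) m n
    (f : 'rV[R]_4 -> 'M[R]_(m, n)) :=
  forall i j, elementary_on U (fun p => f p i j).

Lemma smooth_elementary_mx U m n (f : 'rV[R]_4 -> 'M[R]_(m, n)) :
  open U -> elementary_mx_on U f -> smooth_on U f.
Proof.
move=> Uo fe k; apply: Ck_on_mx => // i j; have [e ef] := fe i j.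
apply: (@Ck_on_ext _ _ _ _ (eval e)) => // [p /ef[_ ->]//|].
by apply: smooth_eval => // p /ef[].
Qed.

Lemma elementary_mulmx U m n r (f : 'rV[R]_4 -> 'M[R]_(m, n))
    (h : 'rV[R]_4 -> 'M[R]_(n, r)) :
  elementary_mx_on U f -> elementary_mx_on U h ->
  elementary_mx_on U (fun p => f p *m h p).
Proof.
move=> fe he i j.
suff [e ee] : elementary_on U (fun p => \sum_k f p i k * h p k j).
  by exists e => p /ee[? <-]; rewrite mxE.
(* Expressions have no finite sums; one is built by recursion on the list of indices. *)
elim: index_enum => [|k s [e ee]].
  by exists (Cst 0) => p _; rewrite big_nil.
have [e1 ee1] := fe i k; have [e2 ee2] := he k j.
exists (Add (Mul e1 e2) e) => p Up; rewrite big_cons /=.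
by have [? ->] := ee p Up; have [? ->] := ee1 p Up; have [? ->] := ee2 p Up.
Qed.

Lemma elementary_cst_mx U m n (C : 'M[R]_(m, n)) :
  elementary_mx_on U (fun=> C).
Proof. by move=> i j; exists (Cst (C i j)). Qed.

Lemma elementary_tr U m n (f : 'rV[R]_4 -> 'M[R]_(m, n)) :
  elementary_mx_on U f -> elementary_mx_on U (fun p => (f p)^T).
Proof.
by move=> fe i j; have [e ee] := fe j i; exists e => p /ee; rewrite mxE.
Qed.

Lemma elementary_mx_ext U m n (f h : 'rV[R]_4 -> 'M[R]_(m, n)) :
  (forall p, U p -> f p = h p) ->
  elementary_mx_on U f -> elementary_mx_on U h.
Proof.
move=> fh fe i j; have [e ee] := fe i j; exists e => p Up.
by have [? <-] := ee p Up; rewrite fh.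
Qed.

End ElementaryExpressions.

(** * Closed 2-forms and the Nijenhuis tensor *)

Section HitchinAlgebra.
Context {R : realType}.
Implicit Types (A B J w : 'M[R]_4) (u v x y z : 'rV[R]_4).

(** The derivative along [v] of a field whose partial derivatives at the point are the [dA i].
    Treating these as given matrices turns the integrability argument into linear algebra at one
    point. *)
Definition directional m n (dA : 'I_4 -> 'M[R]_(m, n)) v : 'M[R]_(m, n) :=
  \sum_i v 0 i *: dA i.

Lemma bilD A B u v : bil (A + B) u v = bil A u v + bil B u v.
Proof. by rewrite /bil mulmxDr mulmxDl mxE. Qed.

Lemma bilN A u v : bil (- A) u v = - bil A u v.
Proof. by rewrite /bil mulmxN mulNmx mxE. Qed.

Lemma bilNl A u v : bil A (- u) v = - bil A u v.
Proof. by rewrite /bil !mulNmx mxE. Qed.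

Lemma bil_mulmxl J A u v : bil (J *m A) u v = bil A (u *m J) v.
Proof. by rewrite /bil !mulmxA. Qed.

Lemma bil_mulmx_tr A J u v : bil (A *m J^T) u v = bil A u (v *m J).
Proof. by rewrite /bil trmx_mul !mulmxA. Qed.

Lemma bil_tr A u v : bil A^T u v = bil A v u.
Proof.
have -> : bil A v u = (v *m A *m u^T)^T 0 0 by rewrite mxE.
by rewrite !trmx_mul trmxK mulmxA.
Qed.

Lemma bilE A u v : bil A u v = \sum_i \sum_j u 0 i * v 0 j * A i j.
Proof.
rewrite /bil mxE exchange_big; apply: eq_bigr => j _ /=.
by rewrite !mxE mulr_suml; apply: eq_bigr => i _; rewrite mulrAC.
Qed.

Lemma bil_directionalE (dA : 'I_4 -> 'M[R]_4) u v z :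
  bil (directional dA u) v z =
  \sum_i \sum_j \sum_k u 0 i * v 0 j * z 0 k * dA i j k.
Proof.
rewrite bilE /directional.
under eq_bigr do under eq_bigr do rewrite summxE mulr_sumr.
under eq_bigr do rewrite exchange_big; rewrite exchange_big /=.
by do 3!apply: eq_bigr => ? _; rewrite mxE; ring.
Qed.

(** The passage from components to vectors: for constant fields [x], [y], [z] the brackets vanish,
    and the exterior derivative is this cyclic sum. *)
Lemma cyclic_bil_directional (dA : 'I_4 -> 'M[R]_4) :
  (forall i j k, dA i j k + dA j k i + dA k i j = 0) -> forall x y z,
  bil (directional dA x) y z + bil (directional dA y) z x
    + bil (directional dA z) x y = 0.
Proof.
move=> cyc x y z; rewrite !bil_directionalE.
have rot (F : 'I_4 -> 'I_4 -> 'I_4 -> R) :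
    \sum_i \sum_j \sum_k F i j k = \sum_k \sum_i \sum_j F i j k.
  by under eq_bigr do rewrite exchange_big /=; rewrite exchange_big.
rewrite [X in _ + X + _]rot [X in _ + X]rot [X in _ + X]rot.
rewrite -2!big_split big1//= => i _.
rewrite -2!big_split big1//= => j _; rewrite -2!big_split big1//= => k _.
by rewrite -[RHS](mulr0 (x 0 i * y 0 j * z 0 k)) -(cyc i j k); ring.
Qed.

Lemma mulmx_directional m n r (A : 'M[R]_(m, n)) (dA : 'I_4 -> 'M[R]_(n, r)) v :
  A *m directional dA v = directional (fun i => A *m dA i) v.
Proof. by rewrite mulmx_sumr; apply: eq_bigr => i _; rewrite scalemxAr. Qed.

Lemma directional_mulmx m n r (dA : 'I_4 -> 'M[R]_(m, n)) (A : 'M[R]_(n, r)) v :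
  directional dA v *m A = directional (fun i => dA i *m A) v.
Proof. by rewrite mulmx_suml; apply: eq_bigr => i _; rewrite scalemxAl. Qed.

Lemma directionalD m n (dA dB : 'I_4 -> 'M[R]_(m, n)) v :
  directional (fun i => dA i + dB i) v = directional dA v + directional dB v.
Proof. by rewrite -big_split; apply: eq_bigr => i _; rewrite scalerDr. Qed.

Lemma directionalN m n (dA : 'I_4 -> 'M[R]_(m, n)) v :
  directional (fun i => - dA i) v = - directional dA v.
Proof. by rewrite -sumrN; apply: eq_bigr => i _; rewrite scalerN. Qed.

Lemma directional_tr m n (dA : 'I_4 -> 'M[R]_(m, n)) v :
  (directional dA v)^T = directional (fun i => (dA i)^T) v.
Proof. by rewrite raddf_sum; apply: eq_bigr => i _; rewrite /= linearZ. Qed.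

(** The Nijenhuis tensor at a point, in terms of [J] and its first derivatives; [nijenhuisE] shows
    that the derivatives of the vector fields cancel. *)
Definition nijenhuis_form J (dJ : 'I_4 -> 'M[R]_4) x y : 'rV[R]_4 :=
  y *m directional dJ x *m J - x *m directional dJ y *m J
  - y *m directional dJ (x *m J) + x *m directional dJ (y *m J).

(** With K = J w, the value w(N(x, y), z) is written through derivatives of K and w. Closedness
    trades all of them for derivatives along [z], which cancel because [J] anticommutes with its
    derivatives. Nondegeneracy of [w] then gives N = 0. *)
Lemma nijenhuis_form_eq0 J w (dJ dw : 'I_4 -> 'M[R]_4) :
  let dK i := dJ i *m w + J *m dw i in
  J *m J = - 1%:M -> w^T = - w -> (J *m w)^T = - (J *m w) -> w \in unitmx ->
  (forall i, dJ i *m J = - (J *m dJ i)) ->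
  (forall i, (dw i)^T = - dw i) -> (forall i, (dK i)^T = - dK i) ->
  (forall i j k, dw i j k + dw j k i + dw k i j = 0) ->
  (forall i j k, dK i j k + dK j k i + dK k i j = 0) ->
  forall x y, nijenhuis_form J dJ x y = 0.
Proof.
move=> dK JJ wT JwT w_unit dJJ dwT dKT cycw cycK x y.
(* Skewness of both [w] and [J *m w] means w(u, J v) = w(J u, v). *)
have Jw : w *m J^T = J *m w.
  by apply: oppr_inj; rewrite -JwT trmx_mul wT mulNmx.
pose D := @directional 4 4.
have DJJ v : D dJ v *m J = - (J *m D dJ v).
  rewrite directional_mulmx mulmx_directional -directionalN.
  by congr directional; apply/funext.
have DK v : D dK v = D dJ v *m w + J *m D dw v.
  by rewrite directional_mulmx mulmx_directional -directionalD.
have skew (dA : 'I_4 -> 'M[R]_4) :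
    (forall i, (dA i)^T = - dA i) -> forall v a b,
    bil (D dA v) a b = - bil (D dA v) b a.
  move=> dAT v a b; rewrite -bilN -bil_tr; congr bil.
  by rewrite directional_tr -directionalN; congr directional; apply/funext.
(* This and [DJJw] eliminate the derivatives of [J] in favour of those of K and w. *)
have DJw v a b : bil (D dJ v *m w) a b =
    bil (D dK v) a b - bil (D dw v) (a *m J) b.
  by rewrite DK bilD (bil_mulmxl J) addrK.
have DJJw v a b : bil (D dJ v *m J *m w) a b =
    - bil (D dK v) (a *m J) b - bil (D dw v) a b.
  rewrite DJJ mulNmx bilN -mulmxA (bil_mulmxl J) DJw.
  by rewrite -mulmxA JJ mulmxN mulmx1 bilNl opprK opprD.
(* The relation between [J] and its derivative along [z], expressed through K and w. *)
have DKJ z : D dK z *m J^T + J *m D dK z + D dw z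
    - J *m D dw z *m J^T = 0.
  have DJwJ : D dJ z *m w *m J^T = - (J *m D dJ z *m w).
    by rewrite -mulmxA Jw mulmxA DJJ mulNmx.
  rewrite DK mulmxDl mulmxDr !mulmxA DJwJ JJ mulNmx mul1mx.
  by rewrite addrA subrK [- _ + _]addrC subrK subrr.
suff Nw : nijenhuis_form J dJ x y *m w = 0.
  by rewrite -[LHS](mulmxK w_unit) Nw mul0mx.
apply/rowP => k; set z : 'rV[R]_4 := delta_mx 0 k.
have -> : (nijenhuis_form J dJ x y *m w) 0 k =
    bil w (nijenhuis_form J dJ x y) z.
  by rewrite /bil /z trmx_delta -colE [RHS]mxE.
rewrite [RHS]mxE /nijenhuis_form.
have -> : bil w (y *m directional dJ x *m J - x *m directional dJ y *m J
  - y *m directional dJ (x *m J) + x *m directional dJ (y *m J)) z =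
   bil (D dJ x *m J *m w) y z - bil (D dJ y *m J *m w) x z
   - bil (D dJ (x *m J) *m w) y z + bil (D dJ (y *m J) *m w) x z.
  by rewrite /bil !mulmxDl !mulNmx !mulmxA !mxE.
rewrite !DJw !DJJw.
have := congr1 (fun A => bil A x y) (DKJ z).
rewrite !bilD bilN -mulmxA !(bil_mulmxl J) !bil_mulmx_tr.
have -> : bil 0 x y = 0 by rewrite /bil mulmx0 mul0mx mxE.
(* The triples are (x, J y, z) and (y, J x, z) for K, and (x, y, z) and (J x, J y, z) for w. The
   derivatives along [z] that they leave add up to [DKJ] evaluated at [x], [y]. *)
have := cyclic_bil_directional cycK x (y *m J) z.
have := cyclic_bil_directional cycK y (x *m J) z.
have := cyclic_bil_directional cycw x y z.
have := cyclic_bil_directional cycw (x *m J) (y *m J) z.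
rewrite -/D.
(* Skewness orders the arguments so that equal terms become syntactically equal, and the goal is
   linear in them. *)
rewrite [bil (D dw (y *m J)) z _]skew// [bil (D dw y) z _]skew//.
rewrite [bil (D dK (x *m J)) z _]skew// [bil (D dK (y *m J)) z _]skew//.
rewrite [bil (D dK z) y _]skew//.
lra.
Qed.

End HitchinAlgebra.

(** * From vector fields to the algebra at a point *)

Section NijenhuisOfFields.
Context {R : realType}.
Implicit Types (U : set 'rV[R]_4) (p : 'rV[R]_4).

Lemma partial_mulmx m n r (f : 'rV[R]_4 -> 'M[R]_(m, n))
    (h : 'rV[R]_4 -> 'M[R]_(n, r)) i p :
  derivable f p (delta_mx 0 i) -> derivable h p (delta_mx 0 i) ->
  derivable (fun q => f q *m h q) p (delta_mx 0 i) /\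
  partial i (fun q => f q *m h q) p =
    partial i f p *m h p + f p *m partial i h p.
Proof.
move=> df dh.
have dfE a b := (derivable_mxP f p (delta_mx 0 i)).1 df a b.
have dhE a b := (derivable_mxP h p (delta_mx 0 i)).1 dh a b.
have E a b : is_derive p (delta_mx 0 i) (fun q => (f q *m h q) a b)
    ((partial i f p *m h p + f p *m partial i h p) a b).
  have -> : (fun q => (f q *m h q) a b) =
      \sum_(k < n) ((fun q => f q a k) * (fun q => h q k b)).
    by apply/funext => q; rewrite mxE fct_sumE.
  apply: is_derive_eq.
    apply: is_derive_sum => k.
    by apply: is_deriveM; apply: derivableP; [exact: dfE|exact: dhE].
  rewrite !mxE -big_split; apply: eq_bigr => k _.
  by rewrite /partial !derive_mx// !mxE addrC /= [_ *: _]mulrC.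
have dfh : derivable (fun q => f q *m h q) p (delta_mx 0 i).
  by apply/derivable_mxP => a b; have [] := E a b.
split=> //; rewrite [LHS]derive_mx//; apply/matrixP => a b.
by rewrite mxE; apply: derive_val.
Qed.

Lemma smooth_on_derivable (V : normedModType R) U (f : 'rV[R]_4 -> V) p i :
  smooth_on U f -> U p -> derivable f p (delta_mx 0 i).
Proof. by move=> /(_ 1%N)[_ /(_ i)[fd _]]; exact: fd. Qed.

Lemma lie_bracketE (X Y : 'rV[R]_4 -> 'rV[R]_4) p :
  lie_bracket X Y p = directional (fun i => partial i Y p) (X p)
                      - directional (fun i => partial i X p) (Y p).
Proof. by rewrite /lie_bracket big_split /= sumrN. Qed.

(** Tensoriality: after the Leibniz rule, the derivatives of [X] and [Y] cancel in pairs because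
    [J p] squares to -1. *)
Lemma nijenhuisE U (J : 'rV[R]_4 -> 'M[R]_4) (X Y : 'rV[R]_4 -> 'rV[R]_4) p :
  smooth_on U J -> smooth_on U X -> smooth_on U Y -> U p ->
  J p *m J p = - 1%:M ->
  nijenhuis J X Y p = nijenhuis_form (J p) (fun i => partial i J p) (X p) (Y p).
Proof.
move=> sJ sX sY Up JJ.
pose D (Z : 'rV[R]_4 -> 'rV[R]_4) := directional (fun i => partial i Z p).
pose DJ := directional (fun i => partial i J p).
have DJE Z v : smooth_on U Z ->
    D (apply_endo J Z) v = D Z v *m J p + Z p *m DJ v.
  move=> sZ; rewrite /D /DJ directional_mulmx mulmx_directional -directionalD.
  congr directional; apply/funext => i.
  by rewrite (partial_mulmx (smooth_on_derivable sZ Up)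
                            (smooth_on_derivable sJ Up)).2.
have bracketE (Z W : 'rV[R]_4 -> 'rV[R]_4) :
    lie_bracket Z W p = D W (Z p) - D Z (W p) by exact: lie_bracketE.
have -> : nijenhuis J X Y p =
    D Y (X p) - D X (Y p)
    + (D Y (X p *m J p) - (D X (Y p) *m J p + X p *m DJ (Y p))) *m J p
    + (D Y (X p) *m J p + Y p *m DJ (X p) - D X (Y p *m J p)) *m J p
    - (D Y (X p *m J p) *m J p + Y p *m DJ (X p *m J p)
       - (D X (Y p *m J p) *m J p + X p *m DJ (Y p *m J p))).
  transitivity (lie_bracket X Y p + lie_bracket (apply_endo J X) Y p *m J p
      + lie_bracket X (apply_endo J Y) p *m J p
      - lie_bracket (apply_endo J X) (apply_endo J Y) p) => //.
  congr (_ + _ + _ - _); [exact: bracketE|congr mulmx|congr mulmx|];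
  by rewrite bracketE; congr (_ - _); exact: DJE.
rewrite /nijenhuis_form -/DJ.
move: (D X) (D Y) DJ {DJE bracketE} => DX DY DJ.
rewrite !(mulmxBl, mulmxDl) -!(mulmxA _ (J p) (J p)) JJ !(mulmxN, mulmx1).
rewrite !mulNmx.
move: (DY (X p *m J p) *m J p) (DX (Y p *m J p) *m J p) (X p *m DJ (Y p) *m J p)
  (Y p *m DJ (X p) *m J p) (Y p *m DJ (X p *m J p)) (X p *m DJ (Y p *m J p)).
by move=> ? ? ? ? ? ?; apply/rowP => k; rewrite !mxE; ring.
Qed.

Lemma near_on (T : Type) U (f h : 'rV[R]_4 -> T) p : open U -> U p ->
  (forall q, U q -> f q = h q) -> \near p, f p = h p.
Proof. by move=> Uo Up fh; apply: filterS fh _; exact: open_nbhs_nbhs. Qed.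

Lemma closed_on_ext U (w w' : 'rV[R]_4 -> 'M[R]_4) : open U ->
  (forall p, U p -> w p = w' p) -> closed_on U w -> closed_on U w'.
Proof.
move=> Uo ww' cw p Up i j k; rewrite /ext_deriv -(cw p Up i j k).
have E l a b : partial l (fun q => w' q a b) p = partial l (fun q => w q a b) p.
  by apply: near_eq_derive; apply: (near_on Uo Up) => q Uq; rewrite ww'.
by rewrite !E.
Qed.

Lemma partial_mx_skew U (w : 'rV[R]_4 -> 'M[R]_4) i p : open U -> U p ->
  derivable w p (delta_mx 0 i) -> (forall q, U q -> (w q)^T = - w q) ->
  (partial i w p)^T = - partial i w p.
Proof.
move=> Uo Up dw wT; rewrite /partial !derive_mx//; apply/matrixP => a b.
have dwE c d := (derivable_mxP w p (delta_mx 0 i)).1 dw c d.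
rewrite !mxE -deriveN//; apply: near_eq_derive; apply: (near_on Uo Up) => q Uq.
by have /matrixP/(_ a b) := wT q Uq; rewrite !mxE.
Qed.

(* The closed 2-form w + sqrt(-1) J w has type (2, 0), so its kernel, the
   bundle of (0, 1)-vectors, is involutive. *)
Lemma integrable_of_closed U (J w : 'rV[R]_4 -> 'M[R]_4) : open U ->
  smooth_on U J -> (forall p, U p -> J p *m J p = - 1%:M) ->
  smooth_on U w -> (forall p, U p -> (w p)^T = - w p) ->
  (forall p, U p -> w p \in unitmx) ->
  (forall p, U p -> (J p *m w p)^T = - (J p *m w p)) ->
  closed_on U w -> closed_on U (fun p => J p *m w p) ->
  integrable_on U J.
Proof.
move=> Uo sJ JJ sw wT w_unit KT cw cK X Y sX sY p Up.
rewrite (nijenhuisE sJ sX sY Up (JJ p Up)).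
have dJ i : derivable J p (delta_mx 0 i) := smooth_on_derivable sJ Up.
have dw i : derivable w p (delta_mx 0 i) := smooth_on_derivable sw Up.
have dK i := (partial_mulmx (dJ i) (dw i)).1.
have dKE i := (partial_mulmx (dJ i) (dw i)).2.
have cyc (v : 'rV[R]_4 -> 'M[R]_4) : (forall i, derivable v p (delta_mx 0 i)) ->
    closed_on U v -> forall i j k,
    partial i v p j k + partial j v p k i + partial k v p i j = 0.
  move=> dv cv i j k; rewrite -[RHS](cv p Up i j k) /ext_deriv.
  have vE l a b : partial l v p a b = partial l (fun q => v q a b) p.
    by rewrite [LHS](congr1 (fun A : 'M[R]_4 => A a b) (derive_mx (dv l))) mxE.
  by rewrite !vE.
apply: (nijenhuis_form_eq0 (w := w p) (dw := fun i => partial i w p)) => //.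
- exact: JJ.
- exact: wT.
- exact: KT.
- exact: w_unit.
(* Differentiating [J *m J], which is constant on [U], gives the anticommutation. *)
- move=> i; apply/eqP; rewrite -addr_eq0 -(partial_mulmx (dJ i) (dJ i)).2.
  rewrite /partial (near_eq_derive _ (near_on Uo Up JJ)).
  exact/eqP/derive_cst.
- by move=> i; exact: partial_mx_skew (dw i) wT.
- by move=> i; rewrite -dKE; exact: partial_mx_skew (dK i) KT.
- exact: cyc.
- by move=> i j k; have := cyc _ dK cK i j k; rewrite !dKE.
Qed.

End NijenhuisOfFields.

(** * The Hodge star in an orthonormal coframe *)

Section HodgeStar.
Context {R : realType}.

Definition rows4 (t : 4.-tuple 'rV[R]_4) : 'M[R]_4 := \matrix_(r < 4) tnth t r.

Lemma invmx_mulmx (F : comUnitRingType) n (A B : 'M[F]_n) :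
  A \in unitmx -> B \in unitmx -> invmx (A *m B) = invmx B *m invmx A.
Proof.
move=> Au Bu; have ABu : A *m B \in unitmx by rewrite unitmx_mul Au.
by rewrite -[RHS](mulKmx ABu) !mulmxA !mulmxK.
Qed.

(** Linearity of the determinant in row [i]: the [B a] share with [A] the cofactors along that
    row. *)
Lemma det_row_expand n (A : 'M[R]_n) (B : 'I_n -> 'M[R]_n) i :
  (forall a, row i (B a) = delta_mx 0 a) ->
  (forall a, row' i (B a) = row' i A) ->
  \det A = \sum_a A i a * \det (B a).
Proof.
move=> Bi Bi'; rewrite (expand_det_row A i).
apply: eq_bigr => a _; congr (_ * _).
rewrite (expand_det_row _ i) (bigD1 a)//= big1 => [|b ba].
  have := congr1 (fun v : 'rV[R]_n => v 0 a) (Bi a); rewrite !mxE !eqxx => ->.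
  rewrite mul1r addr0 /cofactor; congr (_ * \det _).
  apply/matrixP => k l.
  have := congr1 (fun M : 'M[R]_(n.-1, n) => M k (lift a l)) (Bi' a).
  by rewrite !mxE.
have := congr1 (fun v : 'rV[R]_n => v 0 b) (Bi a).
rewrite !mxE (negPf ba) => ->.
by rewrite andbF mul0r.
Qed.

(** Case analysis that produces the numerals of ['I_4], on which tables and tuples compute. *)
Lemma ord4_ind (P : 'I_4 -> Prop) : P 0 -> P 1 -> P 2 -> P 3 -> forall k, P k.
Proof.
move=> P0 P1 P2 P3 [[|[|[|[|//]]]] lt_k].
- by rewrite (_ : Ordinal _ = 0)//; exact: val_inj.
- by rewrite (_ : Ordinal _ = 1)//; exact: val_inj.
- by rewrite (_ : Ordinal _ = 2)//; exact: val_inj.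
- by rewrite (_ : Ordinal _ = 3)//; exact: val_inj.
Qed.

Lemma levi_civitaE a b c d : levi_civita R a b c d =
  \det (rows4 [tuple delta_mx 0 a; delta_mx 0 b; delta_mx 0 c; delta_mx 0 d]).
Proof.
by congr (\det _); apply/row_matrixP; apply: ord4_ind; rewrite !rowK.
Qed.

Lemma det_rows4 (u v w z : 'rV[R]_4) :
  \det (rows4 [tuple u; v; w; z]) =
  \sum_a \sum_b \sum_c \sum_d
    u 0 a * v 0 b * w 0 c * z 0 d * levi_civita R a b c d.
Proof.
pose e (a : 'I_4) : 'rV[R]_4 := delta_mx 0 a.
have E i t (s : 'I_4 -> 4.-tuple 'rV[R]_4) : (forall a, tnth (s a) i = e a) ->
    (forall a k, k != i -> tnth (s a) k = tnth t k) ->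
    \det (rows4 t) = \sum_a tnth t i 0 a * \det (rows4 (s a)).
  move=> si sk; rewrite (@det_row_expand _ _ (fun a => rows4 (s a)) i).
  - by apply: eq_bigr => a _; rewrite mxE.
  - by move=> a; rewrite rowK si.
  - by move=> a; apply/matrixP => k l; rewrite !mxE sk// eq_sym neq_lift.
rewrite (E 0 _ (fun a => [tuple e a; v; w; z]))//;
  last by move=> a; exact: ord4_ind.
apply: eq_bigr => a _; rewrite (E 1 _ (fun b => [tuple e a; e b; w; z]))//;
  last by move=> b; exact: ord4_ind.
rewrite mulr_sumr; apply: eq_bigr => b _.
rewrite (E 2 _ (fun c => [tuple e a; e b; e c; z]))//;
  last by move=> c; exact: ord4_ind.
rewrite !mulr_sumr; apply: eq_bigr => c _.
rewrite (E 3 _ (fun d => [tuple e a; e b; e c; e d]))//;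
  last by move=> d; exact: ord4_ind.
rewrite !mulr_sumr; apply: eq_bigr => d _.
by rewrite !(tnth_nth 0) /= !mulrA levi_civitaE.
Qed.

(* Twice the Hodge star of C in an orthonormal oriented coframe *)
Definition contract_levi_civita (C : 'M[R]_4) : 'M[R]_4 :=
  \matrix_(i, j) \sum_k \sum_l levi_civita R k l i j * C k l.

(** The signed volume factor is [\det E], and its product with the Levi-Civita symbol is the
    determinant of four rows of [E]. Expanding that determinant moves the contraction to coframe
    components. *)
Lemma hodge_star_coframe (E C : 'M[R]_4) : E \in unitmx ->
  hodge_star (E *m E^T) (\det E) (E *m C *m E^T) =
  2^-1 *: (E *m contract_levi_civita C *m E^T).
Proof.
move=> Eu; rewrite /hodge_star.
have ETu : E^T \in unitmx by rewrite unitmx_tr.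
have -> : Num.sg (\det E) * Num.sqrt (\det (E *m E^T)) = \det E.
  by rewrite det_mulmx det_tr -expr2 sqrtr_sqr -numEsg.
move A_def: (_ *m (E *m C *m E^T) *m _) => A.
(* [A] is the form with raised indices; in an orthonormal coframe, raising indices leaves the
   components [C] unchanged. *)
have CE : C = E^T *m A *m E.
  rewrite -A_def invmx_mulmx// trmx_mul !trmx_inv trmxK !mulmxA.
  rewrite mulmxV// mul1mx mulVmx// mul1mx.
  by rewrite mulmxK// mulmxKV.
apply/matrixP => i j; rewrite [LHS]mxE [RHS]mxE; congr (_ * _).
have levi k l : \det E * levi_civita R k l i j =
    \det (rows4 [tuple row k E; row l E; row i E; row j E]).
  rewrite mulrC -det_mulmx; congr (\det _); apply/row_matrixP => r.
  rewrite row_mul rowK -rowE rowK.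
  by move: r; apply: ord4_ind.
have -> : (E *m contract_levi_civita C *m E^T) i j =
    bil (contract_levi_civita C) (row i E) (row j E).
  rewrite /bil tr_row -row_mul [LHS]mxE [RHS]mxE.
  by apply: eq_bigr => k _; rewrite !mxE.
have CE' a b : C a b = bil A (col a E)^T (col b E)^T.
  rewrite CE /bil trmxK tr_col -row_mul [LHS]mxE [RHS]mxE.
  by apply: eq_bigr => k _; rewrite !mxE.
(* The pair [x] holds the contracted coordinate indices; [y] and [z] hold coframe indices,
   contracted with [C] and left free by the star respectively. *)
pose T (x y z : 'I_4 * 'I_4) := E x.1 y.1 * E x.2 y.2 * E i z.1 * E j z.2
  * levi_civita R y.1 y.2 z.1 z.2 * A x.1 x.2.
transitivity (\sum_x \sum_y \sum_z T x y z).
  rewrite pair_bigA; apply: eq_bigr => x _ /=.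
  rewrite levi det_rows4 pair_bigA mulr_suml; apply: eq_bigr => y _ /=.
  rewrite pair_bigA mulr_suml; apply: eq_bigr => z _ /=.
  by rewrite /T !mxE.
transitivity (\sum_z \sum_y \sum_x T x y z).
  rewrite exchange_big [RHS]exchange_big; apply: eq_bigr => y _ /=.
  by rewrite exchange_big.
rewrite bilE [RHS]pair_bigA; apply: eq_bigr => z _ /=.
rewrite [contract_levi_civita _ _ _]mxE [X in _ * X]pair_bigA mulr_sumr.
apply: eq_bigr => y _ /=.
rewrite CE' bilE [X in _ * (_ * X)]pair_bigA !mulr_sumr.
apply: eq_bigr => x _ /=.
by rewrite /T !mxE; ring.
Qed.

End HodgeStar.

(** * Constant matrices in the frame: self-duality and quaternions *)

Section FrameAlgebra.
Context {R : realType}.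
Implicit Types (a b : 'cV[R]_4) (E C : 'M[R]_4).

Lemma sum_ord4 (V : nmodType) (F : 'I_4 -> V) :
  \sum_i F i = F 0 + F 1 + F 2 + F 3.
Proof.
rewrite !big_ord_recl big_ord0 addr0 !addrA.
by congr (_ + F _ + F _ + F _); exact: val_inj.
Qed.

(** Cofactor expansion along the first row, with entries indexed by [nat] so that it evaluates on
    concrete indices. *)
Definition laplace4 (B : nat -> nat -> R) : R :=
  let m i j := B 2%N i * B 3%N j - B 2%N j * B 3%N i in
  let m3 i j k := B 1%N i * m j k - B 1%N j * m i k + B 1%N k * m i j in
  B 0%N 0%N * m3 1%N 2%N 3%N - B 0%N 1%N * m3 0%N 2%N 3%N
  + B 0%N 2%N * m3 0%N 1%N 3%N - B 0%N 3%N * m3 0%N 1%N 2%N.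

Lemma det_laplace4 (B : nat -> nat -> R) :
  \det (\matrix_(i < 4, j < 4) B i j) = laplace4 B.
Proof.
do 3!rewrite !(expand_det_row _ ord0) !big_ord_recl !big_ord0 /cofactor.
rewrite !det_mx11 !mxE /= /bump /= !addn0 add0n !exprS expr0 /laplace4; ring.
Qed.

Lemma levi_civita_laplace4 (i j k l : 'I_4) : levi_civita R i j k l =
  laplace4 (fun r s => (s == nth 0%N [:: val i; val j; val k; val l] r)%:R).
Proof.
rewrite -det_laplace4; congr (\det _); apply/matrixP; apply: ord4_ind => s;
by rewrite !mxE (tnth_nth 0) eqxx.
Qed.

Definition basis_cV (i : 'I_4) : 'cV[R]_4 := delta_mx i 0.

(** This matrix has two roles: its rows are the frame components of the J_1 e_a, and, the frame
    being orthonormal, its entries are the coframe components of omega_1. The next two definitions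
    do the same for J_2 and J_3. *)
Definition frame_J1 : 'M[R]_4 :=
  wedge (basis_cV 0) (basis_cV 1) + wedge (basis_cV 2) (basis_cV 3).
Definition frame_J2 : 'M[R]_4 :=
  wedge (basis_cV 0) (basis_cV 3) + wedge (basis_cV 1) (basis_cV 2).
Definition frame_J3 : 'M[R]_4 :=
  wedge (basis_cV 0) (basis_cV 2) + wedge (basis_cV 3) (basis_cV 1).

Lemma wedge_basisE i j k l : wedge (basis_cV i) (basis_cV j) k l =
  ((k == i) && (l == j))%:R - ((k == j) && (l == i))%:R.
Proof.
by rewrite !mxE !big_ord1 !mxE !andbT -!natrM !mulnb.
Qed.

Lemma trmx_wedge a b : (wedge a b)^T = - wedge a b.
Proof. by rewrite linearB /= !trmx_mul !trmxK opprB. Qed.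

Lemma mulmx_wedge E a b : E *m wedge a b *m E^T = wedge (E *m a) (E *m b).
Proof. by rewrite /wedge /tensor mulmxBr mulmxBl !trmx_mul !mulmxA. Qed.

Lemma contract_levi_civitaD C C' :
  contract_levi_civita (C + C') =
  contract_levi_civita C + contract_levi_civita C'.
Proof.
apply/matrixP => i j; rewrite !mxE -big_split; apply: eq_bigr => k _ /=.
by rewrite -big_split; apply: eq_bigr => l _ /=; rewrite mxE mulrDr.
Qed.

Lemma contract_levi_civita_wedge i j k l :
  contract_levi_civita (wedge (basis_cV i) (basis_cV j)) k l =
  levi_civita R i j k l - levi_civita R j i k l.
Proof.
rewrite mxE; under eq_bigr do under eq_bigr do rewrite wedge_basisE mulrBr.
have pick c d :
    \sum_m \sum_n levi_civita R m n k l * ((m == c) && (n == d))%:R =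
    levi_civita R c d k l.
  rewrite (bigD1 c)//= (bigD1 d)//= !eqxx mulr1 !big1 ?addr0// => [m mc|n nd].
    by rewrite big1// => n _; rewrite (negPf mc) mulr0.
  by rewrite (negPf nd) andbF mulr0.
by rewrite -!pick -sumrB; apply: eq_bigr => m _; rewrite -sumrB.
Qed.

(** Self-duality in the coframe. The factor 2 comes from summing over ordered pairs and cancels the
    [2^-1] of [hodge_star]. *)
Lemma contract_levi_civita_frame :
  [/\ contract_levi_civita frame_J1 = 2 *: frame_J1,
      contract_levi_civita frame_J2 = 2 *: frame_J2
    & contract_levi_civita frame_J3 = 2 *: frame_J3].
Proof.
split; rewrite contract_levi_civitaD; apply/matrixP => i j;
rewrite mxE [RHS]mxE [in RHS]mxE !contract_levi_civita_wedge !wedge_basisE;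
move: i j; do 2!apply: ord4_ind;
rewrite !levi_civita_laplace4 /laplace4 /=; ring.
Qed.

Lemma frame_quaternions :
  [/\ frame_J1 *m frame_J1 = - 1%:M,
      frame_J2 *m frame_J2 = - 1%:M,
      frame_J1 *m frame_J2 = frame_J3  & frame_J2 *m frame_J1 = - frame_J3 ].
Proof.
have wedge2E (a b c d k l : 'I_4) :
    (wedge (basis_cV a) (basis_cV b) + wedge (basis_cV c) (basis_cV d)) k l =
    ((k == a) && (l == b))%:R - ((k == b) && (l == a))%:R
    + (((k == c) && (l == d))%:R - ((k == d) && (l == c))%:R) :> R.
  by rewrite mxE !wedge_basisE.
have oppE (A : 'M[R]_4) i j : (- A) i j = - A i j by rewrite mxE.
rewrite /frame_J1 /frame_J2 /frame_J3; split; apply/matrixP => i j;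
rewrite [LHS]mxE sum_ord4 !wedge2E ?oppE ?wedge2E ?mxE;
move: i j; do 2!apply: ord4_ind; rewrite /=; ring.
Qed.

Lemma frame_J1_rows4 : frame_J1 = @rows4 R
  [tuple delta_mx 0 1; - delta_mx 0 0; delta_mx 0 3; - delta_mx 0 2].
Proof.
apply/matrixP => i j; rewrite mxE !wedge_basisE mxE.
by move: i j; do 2!apply: ord4_ind;
rewrite (tnth_nth 0) !mxE /= ?(subr0, sub0r, add0r, addr0, oppr0).
Qed.

Lemma frame_J2_rows4 : frame_J2 = @rows4 R
  [tuple delta_mx 0 3; delta_mx 0 2; - delta_mx 0 1; - delta_mx 0 0].
Proof.
apply/matrixP => i j; rewrite mxE !wedge_basisE mxE.
by move: i j; do 2!apply: ord4_ind;
rewrite (tnth_nth 0) !mxE /= ?(subr0, sub0r, add0r, addr0, oppr0).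
Qed.

Lemma frame_J3_rows4 : frame_J3 = @rows4 R
  [tuple delta_mx 0 2; - delta_mx 0 3; - delta_mx 0 0; delta_mx 0 1].
Proof.
apply/matrixP => i j; rewrite mxE !wedge_basisE mxE.
by move: i j; do 2!apply: ord4_ind;
rewrite (tnth_nth 0) !mxE /= ?(subr0, sub0r, add0r, addr0, oppr0).
Qed.

Lemma sum_col_row n (A : 'M[R]_n) (B : 'M[R]_n) :
  \sum_i col i A *m row i B = A *m B.
Proof.
apply/matrixP => k l; rewrite summxE mxE; apply: eq_bigr => i _.
by rewrite mxE big_ord1 !mxE.
Qed.

Lemma rows4_mulmx (u v w z : 'rV[R]_4) E :
  rows4 [tuple u; v; w; z] *m E = rows4 [tuple u *m E; v *m E; w *m E; z *m E].
Proof.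
by apply/row_matrixP; apply: ord4_ind; rewrite row_mul !rowK !(tnth_nth 0).
Qed.

End FrameAlgebra.

(** * The Taub-NUT metric *)

Declare Scope expr_scope.
Delimit Scope expr_scope with X.
Local Notation "a + b" := (Add a b) : expr_scope.
Local Notation "a * b" := (Mul a b) : expr_scope.
Local Notation "- a" := (Mul (Cst (-1)) a) : expr_scope.
Local Notation "a - b" := (Add a (- b)%X) : expr_scope.
Local Notation "a / b" := (Mul a (App Inv b)) : expr_scope.

(** * Matrices of symbolic expressions *)

Section ExpressionMatrices.
Context {R : realType}.
Implicit Types (T : seq (seq (@expr R))) (U : set 'rV[R]_4).

Definition entry T (i j : 'I_4) : expr := nth (Cst 0) (nth [::] T i) j.

Definition eval_mx T (p : 'rV[R]_4) : 'M[R]_4 :=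
  \matrix_(i, j) eval (entry T i j) p.

Lemma elementary_eval_mx U T : (forall i j p, U p -> defined (entry T i j) p) ->
  elementary_mx_on U (eval_mx T).
Proof.
move=> dT i j; exists (entry T i j) => p Up.
by rewrite mxE; split=> //; exact: dT.
Qed.

Lemma closed_eval_mx U T :
  (forall i j p, U p -> defined (entry T i j) p) ->
  (forall i j k p, U p -> eval (diff_expr i (entry T j k)) p
     + eval (diff_expr j (entry T k i)) p
     + eval (diff_expr k (entry T i j)) p = 0) ->
  closed_on U (eval_mx T).
Proof.
move=> dT cT p Up i j k; rewrite /ext_deriv -(cT i j k p Up).
have E l a b : partial l (fun q => eval_mx T q a b) p =
    eval (diff_expr l (entry T a b)) p.
  rewrite -partial_eval; last exact: dT.
  by congr (partial l _ p); apply/funext => q; rewrite mxE.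
by rewrite !E.
Qed.

End ExpressionMatrices.

(** * Explicit coframe, frame and 2-forms *)

Section TaubNUT.
Context {R : realType}.
Implicit Types p : 'rV[R]_4.

Let r : @expr R := Var 0.
Let st : @expr R := App Sin (Var 1).
Let ct : @expr R := App Cos (Var 1).
Let sf : @expr R := App Sin (Var 2).
Let cf : @expr R := App Cos (Var 2).
Let s : @expr R := App Sqrt ((r + Cst 1) / (Cst 4 * r))%X.
Let q : @expr R := App Sqrt (r / (Cst 4 * (r + Cst 1)))%X.
Let o : @expr R := Cst 0.

Definition coframe_table : seq (seq (@expr R)) :=
  [:: [:: s * (st * cf); s * (st * sf); s * ct; o];
      [:: s * (r * ct * cf); s * (r * ct * sf); - (s * (r * st)); o];
      [:: - (s * (r * st * sf)); s * (r * st * cf); o; q * ct];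
      [:: o; o; o; q]]%X.

(** The inverse of the coframe matrix. The first three rows are the Cartesian fields d/dx, d/dy,
    d/dz in spherical coordinates divided by [s], with the psi-component that makes e^4 vanish on
    them. *)
Definition frame_table : seq (seq (@expr R)) :=
  [:: [:: st * cf / s; ct * cf / (s * r); - (sf / (s * r * st));
          ct * sf / (s * r * st)];
      [:: st * sf / s; ct * sf / (s * r); cf / (s * r * st);
          - (ct * cf / (s * r * st))];
      [:: ct / s; - (st / (s * r)); o; o];
      [:: o; o; o; Cst 1 / q]]%X.

Let skew (a01 a02 a03 a12 a13 a23 : @expr R) : seq (seq (@expr R)) :=
  [:: [:: o; a01; a02; a03];
      [:: - a01; o; a12; a13];
      [:: - a02; - a12; o; a23];
      [:: - a03; - a13; - a23; o]]%X.

Let f4 : @expr R := Cst (4^-1).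

(* The entries are left unsimplified by cos^2 + sin^2 = 1, so that they agree
   with those of E C_i E^T as rational functions. *)
Definition omega1_table := (skew o
  (f4 * ((r + Cst 1) * (st * st) * (cf * cf + sf * sf) + ct * ct))
  (f4 * ct)
  (f4 * (r * (r + Cst 1) * (ct * st) * (cf * cf + sf * sf) - r * st * ct))
  (- (f4 * (r * st))) o)%X.

Definition omega2_table := (skew
  (- (f4 * ((r + Cst 1) * sf * (st * st + ct * ct))))
  (- (f4 * (r * st * ct * cf))) (f4 * (st * cf))
  (f4 * (r * (ct * ct) * cf + r * (r + Cst 1) * (st * st) * cf))
  (f4 * (r * ct * cf)) (- (f4 * (r * st * sf))))%X.

Definition omega3_table := (skew
  (- (f4 * ((r + Cst 1) * cf * (st * st + ct * ct))))
  (f4 * (r * st * ct * sf)) (- (f4 * (st * sf)))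
  (- (f4 * (r * (ct * ct) * sf + r * (r + Cst 1) * (st * st) * sf)))
  (- (f4 * (r * ct * sf))) (- (f4 * (r * st * cf))))%X.

Lemma coframe_mxE p : TN_coframe_mx p = eval_mx coframe_table p.
Proof.
apply/matrixP => i j; rewrite [LHS]mxE [RHS]mxE /TN_coframe (tnth_nth 0).
move: i j; do 2!apply: ord4_ind; rewrite /= !mxE /= /rho /theta /phi; ring.
Qed.

Lemma TN_dom_open : open (@TN_dom R).
Proof.
have op (i : 'I_4) (D : set R) :
    open D -> open ((fun p : 'rV[R]_4 => p 0 i) @^-1` D).
  by move=> Do; apply: open_comp => // p _; exact: coord_continuous.
have -> : @TN_dom R = (fun p : 'rV[R]_4 => p 0 0) @^-1` [set` `]0, +oo[] `&`
    (fun p : 'rV[R]_4 => p 0 1) @^-1` [set` `]0, pi[].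
  by apply/seteqP; split=> p /=; rewrite !in_itv/= andbT.
by apply: openI; apply: op; exact: interval_open.
Qed.

Lemma coframe_scale_defined p : TN_dom p ->
  [/\ defined s p, defined q p, 0 < eval s p & 0 < eval q p].
Proof.
move=> -[r0 _]; rewrite /rho in r0; have r1 : 0 < p 0 0 + 1 by lra.
have V0 : 0 < (p 0 0 + 1) / (4 * p 0 0) by rewrite divr_gt0// mulr_gt0.
have W0 : 0 < p 0 0 / (4 * (p 0 0 + 1)) by rewrite divr_gt0// mulr_gt0.
have [r_neq0 r1_neq0] : 4 * p 0 0 != 0 /\ 4 * (p 0 0 + 1) != 0.
  by rewrite !mulf_neq0// gt_eqF.
by split; rewrite /= ?sqrtr_gt0//; repeat split.
Qed.

Lemma coframe_defined i j p : TN_dom p -> defined (entry coframe_table i j) p.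
Proof.
move=> /coframe_scale_defined[ds dq _ _]; rewrite /coframe_table.
(* The roots become opaque expressions, so that simplification does not unfold them. *)
move: s q ds dq => s' q' ds dq.
by move: i j; do 2!apply: ord4_ind; repeat split.
Qed.

Lemma frame_defined i j p : TN_dom p -> defined (entry frame_table i j) p.
Proof.
move=> pd; have [ds dq /lt0r_neq0 s0 /lt0r_neq0 q0] := coframe_scale_defined pd.
have [/lt0r_neq0 r0 /sin_gt0_pi/lt0r_neq0 st0] := pd.
rewrite /frame_table; move: s q ds dq s0 q0 => s' q' ds dq s0 q0.
have sr0 : eval s' p * p 0 0 != 0 by rewrite mulf_neq0.
have srst0 : eval s' p * p 0 0 * sin (p 0 1) != 0 by rewrite mulf_neq0.
by move: i j; do 2!apply: ord4_ind; repeat split.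
Qed.

Lemma coframe_mulmx_frame p : TN_dom p ->
  eval_mx coframe_table p *m eval_mx frame_table p = 1%:M.
Proof.
move=> pd; have [ds dq /lt0r_neq0 s0 /lt0r_neq0 q0] := coframe_scale_defined pd.
have [/lt0r_neq0 r0 /sin_gt0_pi/lt0r_neq0 st0] := pd.
rewrite /coframe_table /frame_table; move: s q ds dq s0 q0 => s' q' ds dq s0 q0.
rewrite /rho in r0; rewrite /theta in st0.
have T := cos2Dsin2 (p 0 1); have F := cos2Dsin2 (p 0 2).
apply/matrixP => i j; rewrite mxE sum_ord4 !mxE; move: i j.
move: T F r0 st0 s0 q0.
set R0 := p 0 0; set ST := sin (p 0 1); set CT := cos (p 0 1).
set SF := sin (p 0 2); set CF := cos (p 0 2).
set S := eval s' p; set Q := eval q' p.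
move=> T F r0 st0 s0 q0.
(* An equality modulo cos^2 + sin^2 = 1 for theta and phi is certified by the coefficients [c1],
   [c2]. *)
have tc c1 c2 x y : x - y = c1 * (CT ^+ 2 + ST ^+ 2 - 1)
    + c2 * (CF ^+ 2 + SF ^+ 2 - 1) -> x = y.
  by rewrite T F !subrr !mulr0 addr0 => /eqP; rewrite subr_eq0 => /eqP.
do 2!apply: ord4_ind; rewrite /= -?/R0 -?/ST -?/CT -?/SF -?/CF -?/S -?/Q;
  try by apply: (tc 0 0); field; rewrite ?s0 ?r0 ?st0 ?q0.
(* The entries left are (0,0), (0,1), (1,0), (1,1), (2,2) and (2,3). *)
- by apply: (tc 1 (ST ^+ 2)); field; rewrite s0 ?r0 ?st0.
- by apply: (tc 0 (ST * CT / R0)); field; rewrite s0 ?r0 ?st0.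
- by apply: (tc 0 (R0 * ST * CT)); field; rewrite s0 ?r0 ?st0.
- by apply: (tc 1 (CT ^+ 2)); field; rewrite s0 ?r0 ?st0.
- by apply: (tc 0 1); field; rewrite s0 ?r0 ?st0 ?q0.
- by apply: (tc 0 (- CT)); field; rewrite s0 ?r0 ?st0 ?q0.
Qed.

(** The forms e^1, e^2, e^3 are [s] times dx, dy, dz in spherical coordinates, and sigma_1^2 +
    sigma_2^2 = (dtheta^2 + sin(theta)^2 dphi^2) / 4. *)
Lemma g_TN_coframe p : TN_dom p ->
  g_TN p = TN_coframe_mx p *m (TN_coframe_mx p)^T.
Proof.
move=> pd; have [_ _ s0 q0] := coframe_scale_defined pd.
have [r0 _] := pd; rewrite /rho in r0.
rewrite coframe_mxE /coframe_table.
have s2 : eval s p ^+ 2 = (p 0 0 + 1) / (4 * p 0 0).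
  by rewrite sqr_sqrtr// ltW// -sqrtr_gt0.
have q2 : eval q p ^+ 2 = p 0 0 / (4 * (p 0 0 + 1)).
  by rewrite sqr_sqrtr// ltW// -sqrtr_gt0.
move: s q s0 q0 s2 q2 => s' q' s0 q0 s2 q2.
have T := cos2Dsin2 (p 0 1); have F := cos2Dsin2 (p 0 2).
have P := cos2Dsin2 (p 0 3).
have r1 : p 0 0 + 1 != 0 by rewrite gt_eqF//; lra.
apply/matrixP => i j; rewrite [RHS]mxE sum_ord4 !mxE !big_ord1 !mxE; move: i j.
move: T F P r0 r1 s0 q0 s2 q2; rewrite /rho /theta /phi /psi.
set R0 := p 0 0; set ST := sin (p 0 1); set CT := cos (p 0 1).
set SF := sin (p 0 2); set CF := cos (p 0 2).
set S := eval s' p; set Q := eval q' p.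
set SP := sin (p 0 3); set CP := cos (p 0 3).
move=> T F P /lt0r_neq0 r0 r1 s0 q0 s2 q2.
(* The coefficients belong, in order, to the Pythagorean relations for theta, phi, psi and to the
   values of [S ^+ 2] and [Q ^+ 2]. *)
have tc c1 c2 c3 c4 c5 x y : x - y = c1 * (CT ^+ 2 + ST ^+ 2 - 1)
    + c2 * (CF ^+ 2 + SF ^+ 2 - 1) + c3 * (CP ^+ 2 + SP ^+ 2 - 1)
    + c4 * (S ^+ 2 - (R0 + 1) / (4 * R0))
    + c5 * (Q ^+ 2 - R0 / (4 * (R0 + 1))) -> x = y.
  by rewrite T F P s2 q2 !subrr !mulr0 !addr0 => /eqP; rewrite subr_eq0 => /eqP.
do 2!apply: ord4_ind; rewrite /= -?/R0 -?/ST -?/CT -?/SF -?/CF -?/S -?/Q;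
  try by apply: (tc 0 0 0 0 0); field; rewrite ?r0 ?r1.
- apply: (tc (- S ^+ 2) (- S ^+ 2 * ST ^+ 2) 0 (- 1) 0).
  by field; rewrite r0 r1.
- by apply: (tc 0 (- S ^+ 2 * R0 * ST * CT) 0 0 0); field; rewrite ?r0 r1.
- by apply: (tc 0 (- S ^+ 2 * R0 * ST * CT) 0 0 0); field; rewrite ?r0 r1.
- apply: (tc (- S ^+ 2 * R0 ^+ 2) (- S ^+ 2 * R0 ^+ 2 * CT ^+ 2)
            (R0 * (R0 + 1) / 4) (- R0 ^+ 2) 0).
  by field; rewrite r0 r1.
- apply: (tc 0 (- S ^+ 2 * R0 ^+ 2 * ST ^+ 2) (R0 * (R0 + 1) / 4 * ST ^+ 2)
            (- R0 ^+ 2 * ST ^+ 2) (- CT ^+ 2)).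
  by field; rewrite r0 r1.
- by apply: (tc 0 0 0 0 (- CT)); field; rewrite ?r0 r1.
- by apply: (tc 0 0 0 0 (- CT)); field; rewrite ?r0 r1.
- by apply: (tc 0 0 0 0 (- 1)); field; rewrite ?r0 r1.
Qed.

Lemma TN_coframe_col a p : TN_coframe a p = col a (TN_coframe_mx p).
Proof. by apply/colP => i; rewrite !mxE. Qed.

(** The roots enter only through s^2 and s q = 1/4, so they disappear from the entries. *)
Lemma omega_tables p : TN_dom p ->
  [/\ wedge (TN_e1 p) (TN_e2 p) + wedge (TN_e3 p) (TN_e4 p) =
      eval_mx omega1_table p,
      wedge (TN_e1 p) (TN_e4 p) + wedge (TN_e2 p) (TN_e3 p) =
      eval_mx omega2_table p
    & wedge (TN_e1 p) (TN_e3 p) + wedge (TN_e4 p) (TN_e2 p) =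
      eval_mx omega3_table p].
Proof.
move=> pd; have [_ _ s0 q0] := coframe_scale_defined pd.
have [/lt0r_neq0 r0 _] := pd; rewrite /rho in r0.
have r1 : p 0 0 + 1 != 0 by case: pd => pr _; rewrite gt_eqF// -/(rho p); lra.
have s2 : eval s p ^+ 2 = (p 0 0 + 1) / (4 * p 0 0).
  by rewrite sqr_sqrtr// ltW// -sqrtr_gt0.
have sq : eval s p * eval q p = 4^-1.
  rewrite /= -sqrtrM; last by rewrite -s2 sqr_ge0.
  have -> : (p 0 0 + 1) / (4 * p 0 0) * (p 0 0 / (4 * (p 0 0 + 1))) = 4^-1 ^+ 2.
    by field; rewrite r0 r1.
  by rewrite sqrtr_sqr ger0_norm// invr_ge0.
have e1E : TN_e1 p = col 0 (eval_mx coframe_table p).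
  by rewrite -coframe_mxE -TN_coframe_col.
have e2E : TN_e2 p = col 1 (eval_mx coframe_table p).
  by rewrite -coframe_mxE -TN_coframe_col.
have e3E : TN_e3 p = col 2 (eval_mx coframe_table p).
  by rewrite -coframe_mxE -TN_coframe_col.
have e4E : TN_e4 p = col 3 (eval_mx coframe_table p).
  by rewrite -coframe_mxE -TN_coframe_col.
rewrite {}e1E {}e2E {}e3E {}e4E /coframe_table.
(* With rho and q solved for in terms of s, the entries become rational
   functions of s and of the sines and cosines. *)
have r4 : 4 * eval s p ^+ 2 - 1 = (p 0 0)^-1 by rewrite s2; field.
have rE : p 0 0 = (4 * eval s p ^+ 2 - 1)^-1 by rewrite r4 invrK.
have qE : eval q p = (4 * eval s p)^-1.
  by rewrite invfM -sq mulrAC mulfV ?mul1r// gt_eqF.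
have r4_neq0 : 4 * eval s p ^+ 2 - 1 != 0 by rewrite r4 invr_eq0.
move/lt0r_neq0: s0 => s0.
move: s q s0 rE qE r4_neq0 {q0 s2 sq r4} => s' q' s0 rE qE r4_neq0.
split; apply/matrixP => i j; rewrite !mxE !big_ord1 !mxE; move: i j;
do 2!apply: ord4_ind; rewrite /= ?rE ?qE; field; by rewrite ?s0 ?r4_neq0.
Qed.

(** The tables contain neither roots nor inverted expressions, so every point qualifies. *)
Lemma omega_table_defined p i j : defined (entry omega1_table i j) p /\
  defined (entry omega2_table i j) p /\ defined (entry omega3_table i j) p.
Proof. by move: i j; do 2!apply: ord4_ind; repeat split. Qed.

Lemma omega1_closed i j k p :
  eval (diff_expr i (entry omega1_table j k)) p
  + eval (diff_expr j (entry omega1_table k i)) p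
  + eval (diff_expr k (entry omega1_table i j)) p = 0.
Proof.
have F := cos2Dsin2 (p 0 2).
(* The relation for phi enters the rho-theta-phi component; the sign of the permutation of (0, 1, 2)
   decides between 1/4 and -1/4. *)
have tc c x : x = c * (sin (p 0 1) * cos (p 0 1))
    * (cos (p 0 2) ^+ 2 + sin (p 0 2) ^+ 2 - 1) -> x = 0.
  by rewrite F !subrr !mulr0.
move: i j k; do 3!apply: ord4_ind; rewrite /=; 
  by [apply: (tc 0); field|apply: (tc 4^-1); field|apply: (tc (- 4^-1)); field].
Qed.

Lemma omega2_closed i j k p :
  eval (diff_expr i (entry omega2_table j k)) p
  + eval (diff_expr j (entry omega2_table k i)) p
  + eval (diff_expr k (entry omega2_table i j)) p = 0.
Proof. by move: i j k; do 3!apply: ord4_ind; rewrite /=; field. Qed.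

Lemma omega3_closed i j k p :
  eval (diff_expr i (entry omega3_table j k)) p
  + eval (diff_expr j (entry omega3_table k i)) p
  + eval (diff_expr k (entry omega3_table i j)) p = 0.
Proof. by move: i j k; do 3!apply: ord4_ind; rewrite /=; field. Qed.

End TaubNUT.

(** * Transfer from constant matrices to fields on the domain *)

Section Assembly.
Context {R : realType}.
Implicit Types (p : 'rV[R]_4) (C : 'M[R]_4).

Local Notation M := (@TN_dom R).
Local Notation E := (@TN_coframe_mx R).

Lemma invmx_coframe p : M p ->
  E p \in unitmx /\ invmx (E p) = eval_mx frame_table p.
Proof.
move=> /coframe_mulmx_frame; rewrite -coframe_mxE => EF.
have [Eu _] := mulmx1_unit EF.
by split=> //; rewrite -[RHS](mulKmx Eu) EF mulmx1.
Qed.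

Lemma coframe_unit p : M p -> E p \in unitmx.
Proof. by move=> /invmx_coframe[]. Qed.

Lemma elementary_coframe : elementary_mx_on M E.
Proof.
apply: (@elementary_mx_ext _ _ _ _ (eval_mx coframe_table)).
  by move=> p _; rewrite coframe_mxE.
by apply: elementary_eval_mx => i j p; exact: coframe_defined.
Qed.

Lemma elementary_frame : elementary_mx_on M (fun p => invmx (E p)).
Proof.
apply: (@elementary_mx_ext _ _ _ _ (eval_mx frame_table)).
  by move=> p /invmx_coframe[].
by apply: elementary_eval_mx => i j p; exact: frame_defined.
Qed.

Lemma TN_endoE (im : 'rV[R]_4 -> 4.-tuple 'rV[R]_4) p :
  TN_endo im p = E p *m rows4 (im p).
Proof.
by rewrite -sum_col_row; apply: eq_bigr => a _; rewrite TN_coframe_col rowK.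
Qed.

Lemma TN_J1E p : TN_J1 p = E p *m frame_J1 *m invmx (E p).
Proof.
by rewrite [LHS]TN_endoE frame_J1_rows4 -mulmxA rows4_mulmx !mulNmx -!rowE.
Qed.

Lemma TN_J2E p : TN_J2 p = E p *m frame_J2 *m invmx (E p).
Proof.
by rewrite [LHS]TN_endoE frame_J2_rows4 -mulmxA rows4_mulmx !mulNmx -!rowE.
Qed.

Lemma TN_J3E p : TN_J3 p = E p *m frame_J3 *m invmx (E p).
Proof.
by rewrite [LHS]TN_endoE frame_J3_rows4 -mulmxA rows4_mulmx !mulNmx -!rowE.
Qed.

(** * Endomorphism fields with constant frame components *)

Section CoframeEndo.
Variables (J : 'rV[R]_4 -> 'M[R]_4) (C : 'M[R]_4).
Hypothesis JE : forall p, J p = E p *m C *m invmx (E p).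

Lemma smooth_coframe_endo : smooth_on M J.
Proof.
apply: smooth_elementary_mx; first exact: TN_dom_open.
apply: (@elementary_mx_ext _ _ _ _ (fun p => E p *m C *m invmx (E p))) => //.
apply: elementary_mulmx; last exact: elementary_frame.
by apply: elementary_mulmx;
  [exact: elementary_coframe|exact: elementary_cst_mx].
Qed.

Lemma coframe_endo_sqr : C *m C = - 1%:M ->
  forall p, M p -> J p *m J p = - 1%:M.
Proof.
move=> CC p Mp; rewrite JE !mulmxA mulmxKV ?coframe_unit//.
by rewrite -[E p *m C *m C]mulmxA CC mulmxN mulmx1 mulNmx mulmxV ?coframe_unit.
Qed.

Lemma frame_coframe_endo a p : M p ->
  TN_frame a p *m J p = row a (C *m invmx (E p)).
Proof.
by move=> /coframe_unit Eu; rewrite JE -row_mul !mulmxA mulVmx// mul1mx.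
Qed.

Lemma kahler_form_coframe p : M p ->
  kahler_form (@g_TN R) J p = E p *m C *m (E p)^T.
Proof.
move=> Mp; rewrite /kahler_form JE g_TN_coframe// !mulmxA.
by rewrite mulmxKV//; exact: coframe_unit.
Qed.

Lemma hermitian_coframe_endo : C *m C^T = 1%:M -> hermitian_on M (@g_TN R) J.
Proof.
move=> CC p Mp X Y.
have JgJ : J p *m g_TN p *m (J p)^T = g_TN p.
  rewrite -/(kahler_form _ J p) kahler_form_coframe// JE !trmx_mul !mulmxA.
  rewrite -[E p *m C *m _ *m _]mulmxA -trmx_mul mulVmx ?coframe_unit//.
  by rewrite trmx1 mulmx1 -[E p *m C *m _]mulmxA CC mulmx1 g_TN_coframe.
by rewrite /bil trmx_mul -[in RHS]JgJ !mulmxA.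
Qed.

(** Hitchin's argument for w with coframe matrix [C']: then J w has coframe matrix [C *m C'], so
    both are forms of the same shape. *)
Lemma integrable_coframe_endo C' :
  C *m C = - 1%:M -> C'^T = - C' -> (C *m C')^T = - (C *m C') ->
  C' *m C' = - 1%:M ->
  closed_on M (fun p => E p *m C' *m (E p)^T) ->
  closed_on M (fun p => E p *m (C *m C') *m (E p)^T) ->
  integrable_on M J.
Proof.
move=> CC CT CCT CC' cC' cCC'.
have C'_unit : C' \in unitmx.
  by have [] := @mulmx1_unit _ _ C' (- C'); rewrite // mulmxN CC' opprK.
pose w p := E p *m C' *m (E p)^T.
have JwE p : M p -> J p *m w p = E p *m (C *m C') *m (E p)^T.
  by move=> Mp; rewrite JE /w !mulmxA mulmxKV ?coframe_unit.
apply: (@integrable_of_closed _ M J w).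
- exact: TN_dom_open.
- exact: smooth_coframe_endo.
- exact: coframe_endo_sqr.
- apply: smooth_elementary_mx; first exact: TN_dom_open.
  apply: elementary_mulmx; last exact/elementary_tr/elementary_coframe.
  by apply: elementary_mulmx;
  [exact: elementary_coframe|exact: elementary_cst_mx].
- by move=> p _; rewrite /w !trmx_mul trmxK CT mulNmx mulmxN mulmxA.
- by move=> p Mp; rewrite !unitmx_mul unitmx_tr coframe_unit// C'_unit.
- move=> p Mp; rewrite JwE// trmx_mul [(E p *m _)^T]trmx_mul trmxK CCT.
  by rewrite mulNmx mulmxN mulmxA.
- exact: cC'.
- by apply: closed_on_ext cCC' => [|p Mp]; [exact: TN_dom_open|rewrite JwE].
Qed.

End CoframeEndo.

Lemma coframe_wedge p a b :
  E p *m wedge (basis_cV a) (basis_cV b) *m (E p)^T =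
  wedge (TN_coframe a p) (TN_coframe b p).
Proof. by rewrite mulmx_wedge -!colE -!TN_coframe_col. Qed.

Lemma coframe_frame_J1 p : E p *m frame_J1 *m (E p)^T =
  wedge (TN_e1 p) (TN_e2 p) + wedge (TN_e3 p) (TN_e4 p).
Proof. by rewrite mulmxDr mulmxDl !coframe_wedge. Qed.

Lemma coframe_frame_J2 p : E p *m frame_J2 *m (E p)^T =
  wedge (TN_e1 p) (TN_e4 p) + wedge (TN_e2 p) (TN_e3 p).
Proof. by rewrite mulmxDr mulmxDl !coframe_wedge. Qed.

Lemma coframe_frame_J3 p : E p *m frame_J3 *m (E p)^T =
  wedge (TN_e1 p) (TN_e3 p) + wedge (TN_e4 p) (TN_e2 p).
Proof. by rewrite mulmxDr mulmxDl !coframe_wedge. Qed.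

Lemma riemannian_g_TN : riemannian_on M (@g_TN R).
Proof.
split.
  apply: smooth_elementary_mx; first exact: TN_dom_open.
  apply: (@elementary_mx_ext _ _ _ _ (fun p => E p *m (E p)^T)).
    by move=> p Mp; rewrite g_TN_coframe.
  by apply: elementary_mulmx;
    [|apply: elementary_tr]; exact: elementary_coframe.
move=> p Mp; rewrite g_TN_coframe//; split=> [u v|v v0].
  by rewrite -bil_tr trmx_mul trmxK.
(* g(v, v) is the sum of the squares of the e^a(v), and these determine [v] since [E p] is
   invertible. *)
have -> : bil (E p *m (E p)^T) v v = \sum_i (v *m E p) 0 i ^+ 2.
  rewrite /bil mulmxA -mulmxA -trmx_mul mxE.
  by apply: eq_bigr => i _; rewrite [_^T _ _]mxE expr2.
rewrite lt0r sumr_ge0 => [|i _]; last exact: sqr_ge0.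
rewrite andbT psumr_eq0 => [|i _]; last exact: sqr_ge0.
apply: contra v0 => /allP vE0; rewrite -[v](mulmxK (coframe_unit Mp)).
suff -> : v *m E p = 0 by rewrite mul0mx.
apply/rowP => i; rewrite [RHS]mxE; apply/eqP; rewrite -sqrf_eq0.
by have := vE0 i (mem_index_enum i).
Qed.

Lemma closed_frame_J1 : closed_on M (fun p => E p *m frame_J1 *m (E p)^T).
Proof.
apply: (@closed_on_ext _ _ (eval_mx omega1_table)); first exact: TN_dom_open.
  by move=> p /omega_tables[<- _ _]; rewrite coframe_frame_J1.
apply: closed_eval_mx => [i j p _|i j k p _]; last exact: omega1_closed.
by have [] := omega_table_defined p i j.
Qed.

Lemma closed_frame_J2 : closed_on M (fun p => E p *m frame_J2 *m (E p)^T).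
Proof.
apply: (@closed_on_ext _ _ (eval_mx omega2_table)); first exact: TN_dom_open.
  by move=> p /omega_tables[_ <- _]; rewrite coframe_frame_J2.
apply: closed_eval_mx => [i j p _|i j k p _]; last exact: omega2_closed.
by have [_ []] := omega_table_defined p i j.
Qed.

Lemma closed_frame_J3 : closed_on M (fun p => E p *m frame_J3 *m (E p)^T).
Proof.
apply: (@closed_on_ext _ _ (eval_mx omega3_table)); first exact: TN_dom_open.
  by move=> p /omega_tables[_ _ <-]; rewrite coframe_frame_J3.
apply: closed_eval_mx => [i j p _|i j k p _]; last exact: omega3_closed.
by have [_ []] := omega_table_defined p i j.
Qed.

(** Meant for [C], [C'] and [C *m C'] running through the cyclic permutations of the three
    quaternion matrices. *)
Lemma kahler_coframe_endo J C C' :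
  (forall p, J p = E p *m C *m invmx (E p)) ->
  C^T = - C -> C'^T = - C' -> (C *m C')^T = - (C *m C') ->
  C *m C = - 1%:M -> C' *m C' = - 1%:M ->
  closed_on M (fun p => E p *m C *m (E p)^T) ->
  closed_on M (fun p => E p *m C' *m (E p)^T) ->
  closed_on M (fun p => E p *m (C *m C') *m (E p)^T) ->
  kahler_on M (@g_TN R) J.
Proof.
move=> JE CT C'T CC'T CC CC' cC cC' cCC'; split.
- exact: riemannian_g_TN.
- split; first exact: smooth_coframe_endo JE.
  exact: coframe_endo_sqr JE CC.
- by apply: hermitian_coframe_endo JE _; rewrite CT mulmxN CC opprK.
- exact: integrable_coframe_endo JE _ CC C'T CC'T CC' cC' cCC'.
- apply: closed_on_ext cC => [|p Mp]; first exact: TN_dom_open.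
  by rewrite (kahler_form_coframe JE).
Qed.

Lemma mulmx_row_col m n r (A : 'M[R]_(m, n)) (B : 'M[R]_(n, r)) i j :
  (row i A *m col j B) 0 0 = (A *m B) i j.
Proof. by rewrite -row_mul !mxE; apply: eq_bigr => k _; rewrite !mxE. Qed.

Lemma dual_frame_TN : dual_frame_on M (@TN_coframe R) (@TN_frame R).
Proof.
move=> p Mp a b; rewrite /pairing TN_coframe_col mulmx_row_col.
by rewrite mulVmx ?coframe_unit// mxE eq_sym.
Qed.

Lemma smooth_frame a : smooth_on M (@TN_frame R a).
Proof.
apply: smooth_elementary_mx; first exact: TN_dom_open.
move=> i j; have [e ee] := elementary_frame a j.
by exists e => p /ee; rewrite mxE.
Qed.

Lemma orthonormal_coframe_TN :
  orthonormal_coframe_on M (@g_TN R) (@TN_coframe R).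
Proof.
move=> p Mp a b; have Eu := coframe_unit Mp.
have Etu : (E p)^T \in unitmx by rewrite unitmx_tr.
rewrite g_TN_coframe// /bil trmxK !TN_coframe_col tr_col -row_mul mulmx_row_col.
rewrite invmx_mulmx// !mulmxA mulmxV// mul1mx mulVmx//.
by rewrite mxE.
Qed.

Lemma hodge_star_coframe_TN p C : M p ->
  contract_levi_civita C = 2 *: C ->
  hodge_star (g_TN p) (TN_orientation p) (E p *m C *m (E p)^T) =
  E p *m C *m (E p)^T.
Proof.
move=> Mp CC; rewrite g_TN_coframe// hodge_star_coframe ?coframe_unit// CC.
by rewrite -scalemxAr -scalemxAl scalerA mulVf ?scale1r.
Qed.

End Assembly.

Theorem mainTheorem1 (R : realType) :
  let M : set 'rV[R]_4 := @TN_dom R in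
  let g : 'rV[R]_4 -> 'M[R]_4 := @g_TN R in
  let J1 : 'rV[R]_4 -> 'M[R]_4 := @TN_J1 R in
  let J2 : 'rV[R]_4 -> 'M[R]_4 := @TN_J2 R in
  let J3 : 'rV[R]_4 -> 'M[R]_4 := @TN_J3 R in
  let e : 'I_4 -> 'rV[R]_4 -> 'rV[R]_4 := @TN_frame R in
  let w1 : 'rV[R]_4 -> 'M[R]_4 := kahler_form g J1 in
  let w2 : 'rV[R]_4 -> 'M[R]_4 := kahler_form g J2 in
  let w3 : 'rV[R]_4 -> 'M[R]_4 := kahler_form g J3 in
  (* the frame is well defined, and the J_i act on it as prescribed *)
  ((dual_frame_on M (@TN_coframe R) e /\ forall a, smooth_on M (e a)) /\
   forall p, M p ->
    [/\ [/\ e 0 p *m J1 p = e 1 p, e 1 p *m J1 p = - e 0 p,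
            e 2 p *m J1 p = e 3 p & e 3 p *m J1 p = - e 2 p],
        [/\ e 0 p *m J2 p = e 3 p, e 1 p *m J2 p = e 2 p,
            e 2 p *m J2 p = - e 1 p & e 3 p *m J2 p = - e 0 p]
      & [/\ e 0 p *m J3 p = e 2 p, e 1 p *m J3 p = - e 3 p,
            e 2 p *m J3 p = - e 0 p & e 3 p *m J3 p = e 1 p]]) /\
  orthonormal_coframe_on M g (@TN_coframe R) /\
  hyperkahler_on M g J1 J2 J3 /\
  ([/\ hermitian_on M g J1, hermitian_on M g J2 & hermitian_on M g J3] /\
   (forall p, M p ->
    [/\ w1 p = wedge (TN_e1 p) (TN_e2 p) + wedge (TN_e3 p) (TN_e4 p),
        w2 p = wedge (TN_e1 p) (TN_e4 p) + wedge (TN_e2 p) (TN_e3 p)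
      & w3 p = wedge (TN_e1 p) (TN_e3 p) + wedge (TN_e4 p) (TN_e2 p)]) /\
   (forall p, M p ->
    [/\ hodge_star (g p) (TN_orientation p) (w1 p) = w1 p,
        hodge_star (g p) (TN_orientation p) (w2 p) = w2 p
      & hodge_star (g p) (TN_orientation p) (w3 p) = w3 p])) /\
  [/\ closed_on M w1, closed_on M w2 & closed_on M w3] /\
  quaternionic_on M J1 J2 J3 /\
  [/\ integrable_on M J1, integrable_on M J2 & integrable_on M J3].
Proof.
move=> M g J1 J2 J3 e w1 w2 w3.
have [C11 C22 C12 C21] := @frame_quaternions R.
(* The remaining products follow by associativity from the four computed entrywise. *)
have C23 : frame_J2 *m frame_J3 = frame_J1 :> 'M[R]_4.
  by rewrite -[frame_J3]opprK -C21 mulmxN mulmxA C22 mulNmx mul1mx opprK.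
have C33 : frame_J3 *m frame_J3 = - 1%:M :> 'M[R]_4.
  by rewrite -{1}C12 -mulmxA C23.
have C32 : frame_J3 *m frame_J2 = - frame_J1 :> 'M[R]_4.
  by rewrite -C12 -mulmxA C22 mulmxN mulmx1.
have C31 : frame_J3 *m frame_J1 = frame_J2 :> 'M[R]_4.
  by rewrite -[frame_J3]opprK -C21 mulNmx -mulmxA C11 mulmxN mulmx1 opprK.
have C13 : frame_J1 *m frame_J3 = - frame_J2 :> 'M[R]_4.
  by rewrite -C12 mulmxA C11 mulNmx mul1mx.
have skewC (a b c d : 'cV[R]_4) :
    (wedge a b + wedge c d)^T = - (wedge a b + wedge c d).
  by rewrite linearD /= !trmx_wedge [RHS]opprD.
have T1 : frame_J1^T = - frame_J1 :> 'M[R]_4 := skewC _ _ _ _.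
have T2 : frame_J2^T = - frame_J2 :> 'M[R]_4 := skewC _ _ _ _.
have T3 : frame_J3^T = - frame_J3 :> 'M[R]_4 := skewC _ _ _ _.
have K1 : kahler_on M g J1.
  apply: (kahler_coframe_endo (@TN_J1E R) T1 T2 _ C11 C22 (@closed_frame_J1 R)
    (@closed_frame_J2 R)); rewrite C12 //.
  exact: closed_frame_J3.
have K2 : kahler_on M g J2.
  apply: (kahler_coframe_endo (@TN_J2E R) T2 T3 _ C22 C33 (@closed_frame_J2 R)
    (@closed_frame_J3 R)); rewrite C23 //.
  exact: closed_frame_J1.
have K3 : kahler_on M g J3.
  apply: (kahler_coframe_endo (@TN_J3E R) T3 T1 _ C33 C11 (@closed_frame_J3 R)
    (@closed_frame_J1 R)); rewrite C31 //.
  exact: closed_frame_J2.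
have Q : quaternionic_on M J1 J2 J3.
  move=> p Mp.
  (* Conjugation by the coframe matrix is multiplicative, so the relations pass from the constant
     matrices to the fields. *)
  have JJ C C' : TN_coframe_mx p *m C *m invmx (TN_coframe_mx p)
      *m (TN_coframe_mx p *m C' *m invmx (TN_coframe_mx p)) =
      TN_coframe_mx p *m (C *m C') *m invmx (TN_coframe_mx p).
    by rewrite !mulmxA mulmxKV ?coframe_unit.
  have EE : TN_coframe_mx p *m invmx (TN_coframe_mx p) = 1%:M.
    by rewrite mulmxV ?coframe_unit.
  rewrite /J1 /J2 /J3 !TN_J1E !TN_J2E !TN_J3E !JJ.
  rewrite C11 C22 C33 C12 C21 C23 C32 C31 C13.
  by rewrite !mulmxN !mulNmx !mulmx1 !opprK EE.
have w1E p : M p -> w1 p = TN_coframe_mx p *m frame_J1 *m (TN_coframe_mx p)^T.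
  exact/kahler_form_coframe/TN_J1E.
have w2E p : M p -> w2 p = TN_coframe_mx p *m frame_J2 *m (TN_coframe_mx p)^T.
  exact/kahler_form_coframe/TN_J2E.
have w3E p : M p -> w3 p = TN_coframe_mx p *m frame_J3 *m (TN_coframe_mx p)^T.
  exact/kahler_form_coframe/TN_J3E.
have [_ _ H1 I1 c1] := K1; have [_ _ H2 I2 c2] := K2; have [_ _ H3 I3 c3] := K3.
split; last split; last split; last split; last split; last split => //.
- split; first by split; [exact: dual_frame_TN|exact: smooth_frame].
  move=> p Mp; rewrite /e !(frame_coframe_endo (@TN_J1E R))//.
  rewrite !(frame_coframe_endo (@TN_J2E R))//.
  rewrite !(frame_coframe_endo (@TN_J3E R))//.
  rewrite frame_J1_rows4 frame_J2_rows4 frame_J3_rows4 !rows4_mulmx !rowK.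
  by rewrite !(tnth_nth 0) /= !mulNmx -!rowE.
- exact: orthonormal_coframe_TN.
- by split.
- split; first by split.
  split=> p Mp; rewrite w1E// w2E// w3E//.
    by rewrite coframe_frame_J1 coframe_frame_J2 coframe_frame_J3.
  have [L1 L2 L3] := @contract_levi_civita_frame R.
  by rewrite !hodge_star_coframe_TN.
- by split; [exact: c1|exact: c2|exact: c3].
Qed.
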